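(* Let $B$ be an $\mathbb{R}^K$-valued fractional Brownian motion with Hurst index $H\in(\frac13,1)$ and rough path lift $\mathbf{B}$, let $\theta=(\theta_1,\dots,\theta_K)\in\mathbb{R}^K_+$, and let $y$ be a pathwise solution of $$\mathrm{d}y_t=u_t(y_t)\,\mathrm{d}t+\sum_{k=1}^K\theta_k\sigma_k(y_t)\,\mathrm{d}\mathbf{B}^k_t .$$ Let $\pi_n=\{iT2^{-n}\}_{i=0}^{2^n}$ be the dyadic partitions of $[0,T]$, let $\mathbb{F}=\{f_1,\dots,f_M\}\subset C^2(\mathbb{R}^d)$, and define $X,X_n\in\mathbb{R}^{M\times K}$ and $Y,Y_n\in\mathbb{R}^M$ by $$X^{mk}=\int_0^T\sigma_k[f_m]^2(y_r)\,\mathrm{d}r,\quad Y^m=\langle f_m(y)\rangle^{(1-2H)}_T,\quad X^{mk}_n=\sum_{[t_i,t_{i+1}]\in\pi_n}\sigma_k[f_m]^2(y_{t_i})(t_{i+1}-t_i),\quad Y^m_n=\langle f_m(y)\rangle^{(1-2H),n}_T .$$ Let $\beta=(\theta_k^2)_{1\le k\le K}$, $\beta_n=\operatorname{arg\,min}_{b\in\mathbb{R}^K}|Y_n-X_nb|$, and $\theta_n=\sqrt{\beta_n}$ (componentwise). Assume that $\mathbb{F}$ is such that the columns of $X$ are linearly independent and $Y\ne\mathbf{0}$. Then, for all $\epsilon\in(0,H)$, almost surely, $$|\beta-\beta_n|=\mathcal{O}_{C_1}\big(\delta_n^{H-\epsilon}\big),$$ where $\delta_n=2^{-n/2}\sqrt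 n$ if $H\le\frac12$, $\delta_n=2^{-n(1-H)}\sqrt n$ if $H>\frac12$, and $C_1=C_1(T,\kappa(X),\|B\|_{H-\epsilon},\|f(y)'\|_{H-\epsilon},[f(y)^\sharp]_{2(H-\epsilon)},[\sigma_k[f]^2(y)]_{H-\epsilon};\ f\in\mathbb{F},\,1\le k\le K)$. Moreover, for all $k$ such that $\beta_k>0$ and for all $\epsilon\in(0,H)$, almost surely, $$|\theta_k-\theta_{n,k}|=\mathcal{O}_{C_1\vee\beta_k^{-1}}\big(\delta_n^{H-\epsilon}\big).$$
   Context: Scaled variation: with $\delta x_{st}=x_t-x_s$, for $\gamma\in\mathbb{R}$ and scalar $x$, $\langle x\rangle^{(\gamma),n}_t=\sum(t_{i+1}-t_i)^\gamma(\delta x_{t_it_{i+1}})^2$, the sum running over the intervals $[t_i,t_{i+1}]$ of $\pi_n$ contained in $[0,t]$, and $\langle x\rangle^{(\gamma)}_t=\lim_n\langle x\rangle^{(\gamma),n}_t$. Fractional Brownian motion with Hurst index $H$: centered Gaussian process $B$ with $\mathbb{E}(B_t\otimes B_s)=\frac12(t^{2H}+s^{2H}-|t-s|^{2H})I_{K\times K}$; a.s. $B\in C^\alpha$ for every $\alpha<H$. Rough path lift: $\Delta_T=\{(s,t)\in[0,T]^2:s\le t\}$; $C^\beta_2$ is the set of $f$ on $\Delta_T$ with $[f]_\beta=\sup_{s<t}|f_{st}|/|t-s|^\beta<\infty$. For $\alpha\in(\frac13,\frac12]$ an $\alpha$-Hölder rough path is $(z,\mathbb{Z})\in C^\alpha([0,T];\mathbb{R}^K)\times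 C^{2\alpha}_2([0,T];\mathbb{R}^{K\times K})$ with $\mathbb{Z}_{st}=\mathbb{Z}_{sr}+\delta z_{sr}\otimes\delta z_{rt}+\mathbb{Z}_{rt}$ for $s\le r\le t$. If $H\in(\frac13,\frac12]$, $\mathbf{B}=(B,\mathbb{B})$, where $\mathbb{B}$ is the a.s. limit in the rough path topology of $\int_s^t\int_s^{t_1}\mathrm{d}B^n_r\otimes\mathrm{d}B^n_{t_1}$ with $B^n$ the piecewise linear interpolations of $B$ along dyadic partitions; a.s. $\mathbf{B}$ is an $\alpha$-Hölder rough path for every $\alpha\in(\frac13,H)$. If $H>\frac12$, $\mathbf{B}=B$. Pathwise solution: write $\tilde\sigma_k=\theta_k\sigma_k$. $u\in C([0,T]\times\mathbb{R}^d;\mathbb{R}^d)$, $\sigma=(\sigma_k)_{1\le k\le K}\in C^{\lfloor1/\alpha\rfloor}(\mathbb{R}^d;\mathbb{R}^{d\times K})$. A.s., for every $\alpha\in(\frac13,H)$ (every $\alpha\in(\frac12,H)$ if $H>\frac12$), $y\in C^\alpha([0,T];\mathbb{R}^d)$, $\delta y_{st}-\int_s^tu_r(y_r)\mathrm{d}r-\sum_k\tilde\sigma_k(y_s)\delta B^k_{st}$ belongs to $C^{2\alpha}_2$, and, if $H\le\frac12$, $\delta y_{st}-\int_s^tu_r(y_r)\mathrm{d}r-\sum_k\tilde\sigma_k(y_s)\delta B^k_{st}-\sum_{k,l}\tilde\sigma_l[\tilde\sigma_k](y_s)\mathbb{B}^{l,k}_{st}$ belongs to $C^{3\alpha}_2$.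 Notation: $\sigma_k[f]=\sum_j\sigma_k^j\partial_{x_j}f$; $\tilde\sigma_l[\tilde\sigma_k]^i=\sum_j\tilde\sigma_l^j\partial_{x_j}\tilde\sigma_k^i$. $f(y)'=(\tilde\sigma_k[f](y))_{1\le k\le K}$ and $f(y)^\sharp_{st}=\delta f(y)_{st}-\sum_k\tilde\sigma_k[f](y_s)\delta B^k_{st}$. $[\cdot]_\alpha$ is the $\alpha$-Hölder seminorm and $\|\cdot\|_\alpha=\|\cdot\|_\infty+[\cdot]_\alpha$. $\kappa(X)=\|X\|_2\,\|(X^TX)^{-1}X^T\|_2$ with $\|\cdot\|_2$ the Frobenius norm. The matrices $X,X_n$ and vectors $Y,Y_n$ are random; the assumptions on $X,Y$ are understood almost surely. Convention: $a_n=\mathcal{O}_C(b_n)$ means that there are a finite constant depending only on the quantities indicated by the subscript (and on $\epsilon$ and the fixed exponents and dimensions), and an $n_0$ (possibly random), such that $|a_n|\le\mathrm{const}\cdot b_n$ for all $n\ge n_0$ (in particular, for such $n$ the minimizer $\beta_n$ is unique and, when $\beta_k>0$, $\beta_{n,k}>0$ so that $\theta_{n,k}$ is well defined). *)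

(* Defs.v *)
From HB Require Import structures.
From mathcomp Require Import all_boot all_order all_algebra.
From mathcomp Require Import all_classical all_reals all_analysis.
Set Implicit Arguments.
Unset Strict Implicit.
Unset Printing Implicit Defensive.
Import Order.TTheory GRing.Theory Num.Theory.
Import numFieldNormedType.Exports.
Local Open Scope classical_set_scope.
Local Open Scope ring_scope.

(* Points of R^d and R^K (values of paths and of vector fields) are row vectors;
   the regression vectors in R^M and R^K are column vectors. *)

Section Norms.
Context {R : realType}.

(* The norm that MathComp-Analysis puts on matrices is the max norm; this is
   the Euclidean one on vectors and the Frobenius one on matrices. *)
Definition euclid_norm {m n : nat} (A : 'M[R]_(m, n)) : R :=
  Num.sqrt (\sum_i \sum_j A i j ^+ 2).

(* The (semi)norms on [0, T] are extended real valued, +oo meaning that the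
   path is not in the corresponding space. [N] is the norm of the target. *)
Definition holder2 {V : Type} (N : V -> R) (T b : R) (g : R -> R -> V) : \bar R :=
  ereal_sup [set (N (g p.1 p.2) / (p.2 - p.1) `^ b)%:E
            | p in [set p : R * R | [/\ 0 <= p.1, p.1 < p.2 & p.2 <= T]]].

Definition incr {V : zmodType} (x : R -> V) (s t : R) : V := x t - x s.

Definition holder {V : zmodType} (N : V -> R) (T a : R) (x : R -> V) : \bar R :=
  holder2 N T a (incr x).

Definition sup_norm {V : Type} (N : V -> R) (T : R) (x : R -> V) : \bar R :=
  ereal_sup [set (N (x t))%:E | t in [set t : R | 0 <= t <= T]].

Definition holder_norm {V : zmodType} (N : V -> R) (T a : R) (x : R -> V) : \bar R :=
  (sup_norm N T x + holder N T a x)%E.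

End Norms.

Section Calculus.
Context {R : realType} {d : nat}.

Definition partial (i : 'I_d) (f : 'rV[R]_d -> R) (x : 'rV[R]_d) : R :=
  'D_(delta_mx 0 i) f x.

Fixpoint is_C (n : nat) (f : 'rV[R]_d -> R) : Prop :=
  match n with
  | 0 => continuous f
  | m.+1 => [/\ continuous f,
               forall i x, derivable f x (delta_mx 0 i)
             & forall i, is_C m (partial i f)]
  end.

(* v[f] for a vector field v and a scalar function f *)
Definition lie (v : 'rV[R]_d -> 'rV[R]_d) (f : 'rV[R]_d -> R) (x : 'rV[R]_d) : R :=
  \sum_j v x 0 j * partial j f x.

(* v[w], for two vector fields: componentwise in w *)
Definition lie_vect (v w : 'rV[R]_d -> 'rV[R]_d) (x : 'rV[R]_d) : 'rV[R]_d :=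
  \row_i lie v (fun z => w z 0 i) x.

End Calculus.

Section Dyadic.
Context {R : realType}.

Definition dyadic (T : R) (n i : nat) : R := i%:R * T / 2 ^+ n.

Definition scaled_variation_n (T g : R) (x : R -> R) (n : nat) (t : R) : R :=
  \sum_(i < 2 ^ n | dyadic T n i.+1 <= t)
    (dyadic T n i.+1 - dyadic T n i) `^ g *
    incr x (dyadic T n i) (dyadic T n i.+1) ^+ 2.

Definition scaled_variation (T g : R) (x : R -> R) (t : R) : R :=
  lim ((fun n => scaled_variation_n T g x n t) @ \oo).

Definition dyadic_index (T : R) (n : nat) (t : R) : nat :=
  Num.truncn (t * 2 ^+ n / T).

(* Piecewise constant a.e. derivative of the piecewise linear interpolation.
   At t = T it involves a value of x beyond T, which is irrelevant: it is
   multiplied by 0 in [interp], and {T} is negligible in [interp_lift]. *)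
Definition interp_slope {K : nat} (T : R) (n : nat) (x : R -> 'rV[R]_K) (t : R)
    : 'rV[R]_K :=
  let i := dyadic_index T n t in
  (2 ^+ n / T) *: incr x (dyadic T n i) (dyadic T n i.+1).

Definition interp {K : nat} (T : R) (n : nat) (x : R -> 'rV[R]_K) (t : R)
    : 'rV[R]_K :=
  let i := dyadic_index T n t in
  x (dyadic T n i) + (t - dyadic T n i) *: interp_slope T n x t.

(* Entry (l, k): \int_s^t \int_s^r dx^l_q dx^k_r along the interpolation of x *)
Definition interp_lift {K : nat} (T : R) (n : nat) (x : R -> 'rV[R]_K) (s t : R)
    : 'M[R]_K :=
  \matrix_(l, k)
    \int[lebesgue_measure]_(r in `[s, t])
      ((\int[lebesgue_measure]_(q in `[s, r]) interp_slope T n x q 0 l) *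
       interp_slope T n x r 0 k).

End Dyadic.

Section RoughPaths.
Context {R : realType} {K : nat}.

(* u^T *m v is the tensor product of the row vectors u and v. *)
Definition is_rough_path (T a : R) (z : R -> 'rV[R]_K) (Z : R -> R -> 'M[R]_K)
    : Prop :=
  [/\ (holder euclid_norm T a z < +oo)%E,
      (holder2 euclid_norm T (2 * a) Z < +oo)%E
    & forall s r t : R, 0 <= s -> s <= r -> r <= t -> t <= T ->
        Z s t = Z s r + (incr z s r)^T *m incr z r t + Z r t].

Definition is_rough_lift (T H : R) (b : R -> 'rV[R]_K) (bb : R -> R -> 'M[R]_K)
    : Prop :=
  forall a : R, 3^-1 < a < H ->
    [/\ is_rough_path T a b bb,
        holder_norm euclid_norm T a (fun t => interp T n b t - b t)
          @[n --> \oo] --> 0%E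
      & holder2 euclid_norm T (2 * a) (fun s t => interp_lift T n b s t - bb s t)
          @[n --> \oo] --> 0%E].

End RoughPaths.

Section FractionalBrownianMotion.
Context {R : realType} {disp : measure_display} {Omega : measurableType disp}.
Variable P : probability Omega R.

(* Normal law with mean m and standard deviation s. The library's
   [normal_prob m 0] is the uniform law on [0, 1], so the degenerate case has
   to be treated apart. *)
Definition gaussian_law (m s : R) (A : set R) : \bar R :=
  if s == 0 then \d_m A else normal_prob m s A.

Definition is_gaussian (X : Omega -> R) : Prop :=
  measurable_fun setT X /\
  exists m s : R, forall A : set R, measurable A ->
    P (X @^-1` A) = gaussian_law m s A.

Definition is_gaussian_process {K : nat} (T : R) (B : Omega -> R -> 'rV[R]_K)
    : Prop :=
  forall (n : nat) (t : 'I_n -> R) (k : 'I_n -> 'I_K) (a : 'I_n -> R),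
    (forall i, 0 <= t i <= T) ->
    is_gaussian (fun w => \sum_i a i * B w (t i) 0 (k i)).

(* Fractional Brownian motion on [0, T], in its version with Hoelder paths *)
Definition is_fBm {K : nat} (T H : R) (B : Omega -> R -> 'rV[R]_K) : Prop :=
  [/\ is_gaussian_process T B,
      forall (t : R) (k : 'I_K), 0 <= t <= T -> ('E_P[fun w => B w t 0%R k] = 0)%E,
      forall (s t : R) (k l : 'I_K), 0 <= s <= T -> 0 <= t <= T ->
        ('E_P[fun w => (B w t 0 k * B w s 0 l)%R])%E =
        (2^-1 * (t `^ (2 * H) + s `^ (2 * H) - `|t - s| `^ (2 * H)) *
         (k == l)%:R)%:E
    & {ae P, forall w, forall a : R, 0 < a < H ->
        (holder euclid_norm T a (B w) < +oo)%E}].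

End FractionalBrownianMotion.

Section Solutions.
Context {R : realType} {d K : nat}.
Implicit Types (u : R -> 'rV[R]_d -> 'rV[R]_d) (y : R -> 'rV[R]_d)
  (tsigma : 'I_K -> 'rV[R]_d -> 'rV[R]_d)
  (b : R -> 'rV[R]_K) (bb : R -> R -> 'M[R]_K).

Definition scale_fields (theta : 'I_K -> R)
    (sigma : 'I_K -> 'rV[R]_d -> 'rV[R]_d) : 'I_K -> 'rV[R]_d -> 'rV[R]_d :=
  fun k x => theta k *: sigma k x.

Definition drift u y (s t : R) : 'rV[R]_d :=
  \row_i \int[lebesgue_measure]_(r in `[s, t]) u r (y r) 0 i.

Definition remainder1 u tsigma b y (s t : R) : 'rV[R]_d :=
  incr y s t - drift u y s t - \sum_k incr b s t 0 k *: tsigma k (y s).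

Definition remainder2 u tsigma b bb y (s t : R) : 'rV[R]_d :=
  remainder1 u tsigma b y s t
  - \sum_k \sum_l bb s t l k *: lie_vect (tsigma l) (tsigma k) (y s).

Definition admissible (H a : R) : Prop :=
  (if H <= 2^-1 then 3^-1 else 2^-1) < a < H.

(* [bb] is used only if H <= 1/2. *)
Definition is_solution (T H : R) u tsigma b bb y : Prop :=
  forall a : R, admissible H a ->
    [/\ (holder euclid_norm T a y < +oo)%E,
        (holder2 euclid_norm T (2 * a) (remainder1 u tsigma b y) < +oo)%E
      & H <= 2^-1 ->
        (holder2 euclid_norm T (3 * a) (remainder2 u tsigma b bb y) < +oo)%E].

(* The controlled path (f(y), f(y)') and its remainder f(y)^# *)
Definition gubinelli tsigma (f : 'rV[R]_d -> R) y (t : R) : 'rV[R]_K :=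
  \row_k lie (tsigma k) f (y t).

Definition sharp tsigma (f : 'rV[R]_d -> R) b y (s t : R) : R :=
  incr (f \o y) s t - \sum_k lie (tsigma k) f (y s) * incr b s t 0 k.

End Solutions.

Section Regression.
Context {R : realType} {d K M : nat}.
Implicit Types (sigma : 'I_K -> 'rV[R]_d -> 'rV[R]_d)
  (f : 'I_M -> 'rV[R]_d -> R) (y : R -> 'rV[R]_d).

Definition Xmat (T : R) sigma f y : 'M[R]_(M, K) :=
  \matrix_(m, k)
    \int[lebesgue_measure]_(r in `[0, T]) (lie (sigma k) (f m) (y r)) ^+ 2.

Definition Xmat_n (T : R) sigma f y (n : nat) : 'M[R]_(M, K) :=
  \matrix_(m, k)
    \sum_(i < 2 ^ n) (lie (sigma k) (f m) (y (dyadic T n i))) ^+ 2 *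
      (dyadic T n i.+1 - dyadic T n i).

Definition Yvec (T H : R) f y : 'cV[R]_M :=
  \col_m scaled_variation T (1 - 2 * H) (f m \o y) T.

Definition Yvec_n (T H : R) f y (n : nat) : 'cV[R]_M :=
  \col_m scaled_variation_n T (1 - 2 * H) (f m \o y) n T.

Definition is_argmin (X : 'M[R]_(M, K)) (Y : 'cV[R]_M) (b : 'cV[R]_K) : Prop :=
  forall c, euclid_norm (Y - X *m b) <= euclid_norm (Y - X *m c).

Definition kappa (X : 'M[R]_(M, K)) : R :=
  euclid_norm X * euclid_norm (invmx (X^T *m X) *m X^T).

Definition rate (H : R) (n : nat) : R :=
  (if H <= 2^-1 then 2 `^ (- (n%:R / 2)) else 2 `^ (- (n%:R * (1 - H))))
  * Num.sqrt n%:R.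

(* The quantities on which a constant may depend: T, kappa(X), |B|_a,
   |f(y)'|_a, [f(y)^#]_(2a) and [sigma_k[f]^2(y)]_a *)
Definition constant_fun : Type :=
  R -> R -> \bar R -> ('I_M -> \bar R) -> ('I_M -> \bar R) ->
  ('I_M -> 'I_K -> \bar R) -> R.

Definition eval_constant (C : constant_fun) (T a : R) (theta : 'I_K -> R) sigma f
    (b : R -> 'rV[R]_K) y : R :=
  let tsigma := scale_fields theta sigma in
  C T (kappa (Xmat T sigma f y))
    (holder_norm euclid_norm T a b)
    (fun m => holder_norm euclid_norm T a (gubinelli tsigma (f m) y))
    (fun m => holder2 Num.norm T (2 * a) (sharp tsigma (f m) b y))
    (fun m k => holder Num.norm T a (fun t => (lie (sigma k) (f m) (y t)) ^+ 2)).

End Regression.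

Arguments constant_fun : clear implicits.

(* Main.v *)
Require Import Defs.
From HB Require Import structures.
From mathcomp Require Import all_boot all_order all_algebra.
From mathcomp Require Import all_classical all_reals all_analysis.
From mathcomp Require Import measurable_realfun ring lra.
Set Implicit Arguments.
Unset Strict Implicit.
Unset Printing Implicit Defensive.
Import Order.TTheory GRing.Theory Num.Theory.
Import numFieldNormedType.Exports.
Local Open Scope classical_set_scope.
Local Open Scope ring_scope.

(** The proof compares, for each f in the family, the scaled variation of
    x = f(y) along the dyadic partition with its prediction X_n beta.

    A Taylor expansion of f and the equation for y give
      x_t - x_s = sum_k g_k(s) (B^k_t - B^k_s) + f(y)^#_{s,t},
    where g_k = theta_k sigma_k[f](y) and f(y)^# is of order
    |t - s|^min(2a, 1) for every Hoelder exponent a < H ([sharp_bound]). Squaring,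
    multiplying by D^(1 - 2H), D being the mesh T / 2^n, and summing over the
    partition, one obtains X_n beta, terms with f(y)^# that are small because of
    its order, and weighted sums
      sum_i g_k(t_i) g_l(t_i) xi_i,  xi_i = D^(1 - 2H) dB^k_i dB^l_i - [k = l] D,
    of centered products of increments ([rate_variation]).

    The weights g_k g_l depend on B, so the weighted sums cannot be treated by
    computing moments. But the weights are Hoelder continuous: they are frozen on
    the blocks of a coarser dyadic partition, of mesh T / 2^m ([two_scale_bound]).
    What remains are the sums of xi over the blocks, which are quadratic
    functionals of B alone and, by polarization, sums of centered squares of
    Gaussian variables. By Isserlis' formula the variance of such a sum is
    2 sum_{i,j} cov(i, j)^2 <= 2 max |cov| sum_{i,j} |cov(i, j)|, and the sum of
    the absolute covariances of increments of fractional Brownian motion can be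
    bounded without asymptotics ([sum_norm_cov_increments]): the covariances of
    different increments are all nonnegative if H >= 1/2 and all nonpositive if
    H <= 1/2, while the sum of all of them is the variance of the increment over
    the whole block. With h = max(H, 1/2), the sum over all blocks of the absolute
    block sums therefore has expectation O(2^(-(n - m)(1 - h))), which is
    summable in n, and this turns into an almost sure bound ([ae_block_error]).
    For m close to (1 - h) n, both this part and the cost of freezing the weights
    are O(2^(- n (1 - h)(H - eps'))) for every eps' > 0.

    It remains to pass from |Y_n - X_n beta| to the estimator. The columns of X
    are linearly independent and X_n converges to X, so X_n is injective with a
    uniform constant for large n ([perturbed_injectivity]); and
    X_n (beta_n - beta) is the orthogonal projection of Y_n - X_n beta on the
    range of X_n ([least_squares]). Hence |beta - beta_n| <= C |Y_n - X_n beta|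
    with a random C.

    Since eps' may be taken smaller than eps, the resulting rate is strictly
    better than the one to be shown, and a random constant is absorbed by it for
    n >= n0(omega). In fact beta - beta_n is almost surely negligible compared
    with delta_n^(H - eps), for each eps, so that the constant 1 is large enough.
    For the square roots, |theta_k - sqrt b| = |theta_k^2 - b| / (theta_k + sqrt b),
    where theta_k > 0 is absorbed in the same way. *)


(** * Moments of the normal density *)

Section GaussianMoments.
Context {R : realType}.
Notation mu := (@lebesgue_measure R).

(** The fundamental theorem of calculus on [-n, n], and dominated convergence. *)
Lemma integral_derivative_eq0 (F f : R -> R) :
  (forall x : R, is_derive x (1 : R) F (f x)) -> continuous f ->
  mu.-integrable setT (EFin \o f) ->
  F n%:R @[n --> \oo] --> 0 -> F (- n%:R) @[n --> \oo] --> 0 ->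
  (\int[mu]_x (f x)%:E = 0)%E.
Proof.
move=> dF cf intf Fy FNy.
have mf := measurable_int mu intf.
pose I (n : nat) : set R := `[- n%:R, n%:R]%classic.
pose fn (n : nat) : R -> \bar R := (EFin \o f) \_ (I n).
have mfn n : measurable_fun [set: R] (fn n).
  apply/(measurable_restrictT _ _).1; first exact: measurable_itv.
  exact: measurable_funTS.
have fnf : {ae mu, forall x, setT x -> fn ^~ x @ \oo --> (EFin \o f) x}.
  apply: aeW => x _.
  apply: cvg_near_cst; near=> n.
  rewrite /fn patchE ifT // inE /I /= in_itv /= -ler_norml ltW //.
  near: n; exact: nbhs_infty_gtr.
have fnd : {ae mu, forall x n, setT x -> (`|fn n x| <= `|(EFin \o f) x|)%E}.
  apply: aeW => x n _; rewrite /fn patchE; case: ifP => //= _.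
  by rewrite normr0 lee_fin.
have [_ _] := @dominated_convergence _ _ R mu setT measurableT fn _
  _ mfn mf fnf (integrable_abse intf) fnd.
rewrite /=.
have -> : (fun n => \int[mu]_x fn n x)%E = fun n => (F n%:R - F (- n%:R))%:E.
  apply/funext => n; rewrite /fn -integral_mkcond.
  case: n => [|n].
    by rewrite /I oppr0 subrr set_itv1 integral_set1.
  rewrite (@continuous_FTC2 R f F) //.
  - by rewrite -subr_gt0 opprK -natrD ltr0n.
  - by apply: continuous_subspaceT => x; exact: cf.
  - have cF x : {for x, continuous F}.
      by apply: differentiable_continuous; apply/derivable1_diffP; case: (dF x).
    split.
    + by move=> x _; case: (dF x).
    + by apply: cvg_at_right_filter; exact: cF.
    + by apply: cvg_at_left_filter; exact: cF.
  - by move=> x _; rewrite derive1E; case: (dF x).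
move=> H; apply/esym; apply: (cvg_unique _ _ H) => //.
rewrite -[0%E]/(0%:E) -(subr0 0); apply: cvg_EFin; first by apply: nearW.
exact: cvgB.
Unshelve. all: by end_near. Qed.

Lemma is_derive_center_pow (m x : R) (k : nat) :
  is_derive x (1 : R) (fun y : R => (y - m) ^+ k) (k%:R * (x - m) ^+ k.-1).
Proof.
have -> : (fun y : R => (y - m) ^+ k) = (shift (- m) : R -> R) ^+ k.
  by apply/funext => y; rewrite fctE.
have d := @is_derive_shift R x 1 (- m).
by have := is_deriveX k d; rewrite /= /GRing.scale /= mulr1.
Qed.

Lemma is_derive_normal_pdf (m s x : R) : s != 0 ->
  is_derive x (1 : R) (normal_pdf m s) (- (x - m) / s ^+ 2 * normal_pdf m s x).
Proof.
move=> s0; rewrite normal_pdfE//.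
have d2 := is_deriveZ (- (s ^+ 2 *+ 2)^-1) (is_derive_center_pow m x 2).
have d3 := is_deriveZ (normal_peak s) (is_derive1_comp (is_derive_expR _) d2).
have -> : (fun x : R => normal_peak s * normal_fun m s x) =
   normal_peak s \*: (expR \o (- (s ^+ 2 *+ 2)^-1 \*: (fun y : R => (y - m) ^+ 2))).
  apply/funext => y; rewrite /normal_fun /= /GRing.scale /=; congr (_ * expR _).
  by rewrite mulNr mulNr mulrC.
apply: is_derive_eq d3 _.
rewrite /GRing.scale /= /normal_fun expr1.
have -> : - (x - m) ^+ 2 / (s ^+ 2 *+ 2) = - (s ^+ 2 *+ 2)^-1 * (x - m) ^+ 2.
  by rewrite !mulNr mulrC.
by field.
Qed.

(** Up to a constant, the quotient of the two densities is exp(-w) with w = 3 (x - m)^2 / (8 s^2),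
    and exp w >= 1 + w^2 / 2 beats the fourth power. *)
Lemma normal_pdf_tail (m s : R) : s != 0 -> exists C : R, forall (k : nat) (x : R),
  (k <= 4)%N -> `|x - m| ^+ k * normal_pdf m s x <= C * normal_pdf m (2 * s) x.
Proof.
move=> s0.
have s20 : 2 * s != 0 by rewrite mulf_neq0.
(* Here 29 only has to exceed 2 * 64 / 9, as (x - m) ^ 4 = 64 / 9 * s ^ 4 * w ^ 2. *)
exists ((1 + 29 * s ^+ 4) * normal_peak s / normal_peak (2 * s)) => k x k4.
rewrite !normal_pdfE// /normal_fun.
set z := x - m.
have p1 := normal_peak_gt0 s0; have p2 := normal_peak_gt0 s20.
have s2 : 0 < s ^+ 2 by rewrite exprn_even_gt0.
set w := 3 * z ^+ 2 / (8 * s ^+ 2).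
have w0 : 0 <= w by rewrite /w; apply: divr_ge0; apply: mulr_ge0; rewrite ?ler0n ?sqr_ge0.
have -> : - z ^+ 2 / (s ^+ 2 *+ 2) = - z ^+ 2 / ((2 * s) ^+ 2 *+ 2) - w.
  by rewrite /w; field.
rewrite expRD expRN.
set e1 := expR (- _ / _).
have e10 : 0 < e1 by exact: expR_gt0.
have -> : (1 + 29 * s ^+ 4) * normal_peak s / normal_peak (2 * s) *
  (normal_peak (2 * s) * e1) = (1 + 29 * s ^+ 4) * (normal_peak s * e1).
  by field; rewrite gt_eqF.
have -> : `|z| ^+ k * (normal_peak s * (e1 / expR w)) =
  (normal_peak s * e1) * (`|z| ^+ k / expR w) by ring.
rewrite [leRHS]mulrC ler_wpM2l//; first by rewrite mulr_ge0// ltW.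
rewrite ler_pdivrMr ?expR_gt0//.
have ew : 1 + w ^+ 2 / 2 <= expR w by exact: (expR_ge1Dxn 1).
have zk : `|z| ^+ k <= 1 + z ^+ 4.
  rewrite -[z ^+ 4](ger0_norm (exprn_even_ge0 _ _))// normrX.
  have [z1|z1] := leP `|z| 1.
    by apply: (@le_trans _ _ 1); [exact: exprn_ile1|rewrite lerDl exprn_ge0].
  apply: (@le_trans _ _ (`|z| ^+ 4)); last by rewrite lerDr.
  by apply: ler_weXn2l => //; exact: ltW.
have zw : z ^+ 4 = 64 / 9 * s ^+ 4 * w ^+ 2.
  by rewrite /w; field.
apply: (le_trans zk); rewrite zw.
have s4 : 0 <= s ^+ 4 by rewrite exprn_even_ge0.
have e1' : 1 <= expR w by nra.
have -> : (1 + 29 * s ^+ 4) * expR w = expR w + s ^+ 4 * (29 * expR w) by ring.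
have -> : 64 / 9 * s ^+ 4 * w ^+ 2 = s ^+ 4 * (64 / 9 * w ^+ 2) by ring.
rewrite lerD// ler_wpM2l//; nra.
Qed.

Lemma integrable_normal_moment (m s : R) (k : nat) : s != 0 -> (k <= 4)%N ->
  mu.-integrable setT (EFin \o (fun x : R => (x - m) ^+ k * normal_pdf m s x)).
Proof.
move=> s0 k4; have [C HC] := normal_pdf_tail m s0.
have iC := @integrableZl _ _ R mu _ measurableT C _ (integrable_normal_pdf m (2 * s)).
apply: le_integrable iC => //.
  apply/measurable_EFinP; apply: measurable_funM; last exact: measurable_normal_pdf.
  by apply: measurable_funX; exact: measurable_funB.
move=> x _ /=; rewrite lee_fin normrM normrX (ger0_norm (normal_pdf_ge0 _ _ _)).
by apply: (le_trans (HC _ _ k4)); exact: ler_norm.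
Qed.

Lemma continuous_center_pow_normal_pdf (m s : R) (k : nat) : s != 0 ->
  continuous (fun x : R => (x - m) ^+ k * normal_pdf m s x).
Proof.
move=> s0 x; apply: cvgM; last exact: continuous_normal_pdf.
suff : {for x, continuous (fun y : R => (y - m) ^+ k)} by [].
apply: differentiable_continuous; apply/derivable1_diffP.
by case: (is_derive_center_pow m x k).
Qed.

Lemma cvg_center_pow_normal_pdf (m s : R) (k : nat) (u : nat -> R) :
  s != 0 -> (k <= 3)%N -> (forall n, `|u n| = n%:R) ->
  (u n - m) ^+ k * normal_pdf m s (u n) @[n --> \oo] --> 0.
Proof.
move=> s0 k3 un; have [C HC] := normal_pdf_tail m s0.
apply/cvgr0Pnorm_lt => e e0.
have s20 : 2 * s != 0 by rewrite mulf_neq0.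
pose D := `|C| * normal_peak (2 * s).
have D0 : 0 <= D by rewrite mulr_ge0// normal_peak_ge0.
near=> n.
have nm : D / e < `|u n - m|.
  have : `|u n| - `|m| <= `|u n - m| by exact: lerB_dist.
  apply: lt_le_trans; rewrite un ltrBrDr.
  by near: n; exact: nbhs_infty_gtr.
have := HC k.+1 (u n) k3; rewrite exprS -mulrA => H.
have u0 : 0 < `|u n - m| by rewrite (le_lt_trans _ nm)// divr_ge0// ltW.
rewrite normrM normrX (ger0_norm (normal_pdf_ge0 _ _ _)).
rewrite -(ltr_pM2l u0) (le_lt_trans H)// (@le_lt_trans _ _ D)//; last first.
  by rewrite -ltr_pdivrMr.
rewrite /D (le_trans (ler_norm _))// normrM ler_wpM2l//.
by rewrite ger0_norm ?normal_pdf_ge0// normal_pdf_ub.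
Unshelve. all: by end_near. Qed.

(** Integration by parts against the Gaussian density. *)
Lemma normal_moment_rec (m s : R) (k : nat) : s != 0 -> (k <= 3)%N ->
  (\int[mu]_x ((x - m) ^+ k.+1 * normal_pdf m s x)%:E =
   (s ^+ 2 * k%:R)%:E * \int[mu]_x ((x - m) ^+ k.-1 * normal_pdf m s x)%:E)%E.
Proof.
move=> s0 k3.
have i1 := integrable_normal_moment (k := k.+1) m s0 k3.
have i2 := integrable_normal_moment (k := k.-1) m s0 (leq_trans (leq_pred k) (leqW k3)).
have i2' := @integrableZl _ _ R mu _ measurableT (s ^+ 2 * k%:R) _ i2.
rewrite -(@integralZl _ _ _ mu _ measurableT _ i2).
have f1 : (\int[mu]_x ((x - m) ^+ k.+1 * normal_pdf m s x)%:E \is a fin_num)%E.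
  exact: integrable_fin_num i1.
have := @integralB _ _ _ mu _ measurableT _ _ i2' i1.
rewrite [LHS](_ : _ = 0%E); last first.
  pose F (x : R) := s ^+ 2 * ((x - m) ^+ k * normal_pdf m s x).
  pose f (x : R) := s ^+ 2 * k%:R * ((x - m) ^+ k.-1 * normal_pdf m s x) -
                    (x - m) ^+ k.+1 * normal_pdf m s x.
  apply: (@integral_derivative_eq0 F f).
  - move=> x; have d1 := is_derive_center_pow m x k.
    have d2 := is_derive_normal_pdf m x s0.
    have d3 := is_deriveZ (s ^+ 2) (is_deriveM d1 d2).
    apply: is_derive_eq d3 _.
    by rewrite /GRing.scale /f /= [_ ^+ k.+1]exprS; field.
  - move=> x; apply: cvgB; last exact: continuous_center_pow_normal_pdf.
    by apply: cvgM; [exact: cvg_cst|exact: continuous_center_pow_normal_pdf].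
  - exact: (@integrableB _ _ R mu _ measurableT _ _ i2' i1).
  - rewrite -(mulr0 (s ^+ 2)); apply: cvgM; first exact: cvg_cst.
    by apply: cvg_center_pow_normal_pdf => // n; rewrite normr_nat.
  - rewrite -(mulr0 (s ^+ 2)); apply: cvgM; first exact: cvg_cst.
    by apply: cvg_center_pow_normal_pdf => // n; rewrite normrN normr_nat.
move/esym/eqP; rewrite sube_eq ?add0e//.
- by move/eqP.
exact: integrable_fin_num i2'.
Qed.
End GaussianMoments.

(** * Fourth moments of Gaussian variables *)

Section Transfer.
Context {R : realType}.
Notation mu := (@lebesgue_measure R).

(** The density is a version of the Radon-Nikodym derivative. *)
Lemma ge0_integral_normal_prob (m s : R) (g : R -> \bar R) :
  (forall x, 0 <= g x)%E -> measurable_fun [set: R] g ->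
  (\int[normal_prob m s]_x g x = \int[mu]_x (g x * (normal_pdf m s x)%:E))%E.
Proof.
move=> g0 mg; have dom := @normal_prob_dominates R m s.
have iD := Radon_Nikodym_SigmaFinite.f_integrable dom.
have ED := Radon_Nikodym_SigmaFinite.f_integral dom.
have mD := measurable_int _ iD.
have ip := @integrable_normal_pdf R m s.
have mp := measurable_int _ ip.
rewrite -(Radon_Nikodym_SigmaFinite.change_of_variables dom g0)//.
apply: ae_eq_integral => //; [exact: emeasurable_funM..|].
apply: ae_eqe_mul2l; apply: integral_ae_eq => //.
by move=> E _ mE; rewrite -ED.
Qed.

Context {disp : measure_display} {Omega : measurableType disp}.
Variable P : probability Omega R.

Section Density.
Variables (m s : R) (X : Omega -> R).
Hypothesis mX : measurable_fun setT X.
Hypothesis lawX : forall A : set R, measurable A -> P (X @^-1` A) = normal_prob m s A.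

Let ge0_transfer (g : R -> R) : (forall x, 0 <= g x) -> measurable_fun [set: R] g ->
  (\int[P]_w (g (X w))%:E = \int[mu]_x (g x * normal_pdf m s x)%:E)%E.
Proof.
move=> g0 mg.
have mg' : measurable_fun [set: R] (EFin \o g) by exact/measurable_EFinP.
pose Y : {RV P >-> measurableTypeR R} :=
  HB.pack X (isMeasurableFun.Build _ _ Omega (measurableTypeR R) X mX).
rewrite -[LHS](ge0_integral_distribution Y mg'); last by move=> x; rewrite lee_fin.
transitivity (\int[normal_prob m s]_x (g x)%:E)%E.
  by apply: eq_measure_integral => A mA _; exact: lawX.
by rewrite [LHS]ge0_integral_normal_prob.
Qed.

Let ge0_integrable_transfer (g : R -> R) : (forall x, 0 <= g x) ->
  measurable_fun [set: R] g ->
  mu.-integrable setT (fun x : R => (g x * normal_pdf m s x)%:E) ->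
  P.-integrable setT (EFin \o (g \o X)).
Proof.
move=> g0 mg /integrableP[_ H]; apply/integrableP; split.
  by apply/measurable_EFinP; exact: measurableT_comp.
under eq_integral => x _ do rewrite /= ger0_norm//.
rewrite ge0_transfer//; apply: le_lt_trans H.
rewrite le_eqVlt; apply/orP; left; apply/eqP; apply: eq_integral => x _ /=.
by rewrite ger0_norm// mulr_ge0 ?normal_pdf_ge0.
Qed.

(** By linearity from the nonnegative case, as g = (|g| + g) - |g|. *)
Lemma normal_transfer (g : R -> R) : measurable_fun [set: R] g ->
  mu.-integrable setT (fun x : R => (g x * normal_pdf m s x)%:E) ->
  P.-integrable setT (EFin \o (g \o X)) /\
  \int[P]_w g (X w) = \int[mu]_x (g x * normal_pdf m s x).
Proof.
move=> mg ig.
have p0 := @normal_pdf_ge0 R m s.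
pose a (x : R) : R := `|g x|; pose b (x : R) : R := `|g x| + g x.
have a0 x : 0 <= a x by rewrite /a.
have b0 x : 0 <= b x by have := ler_norm (- g x); rewrite normrN /b; lra.
have ma : measurable_fun [set: R] a by exact: measurableT_comp.
have mb : measurable_fun [set: R] b by exact: measurable_funD.
have ia : mu.-integrable setT (fun x : R => (a x * normal_pdf m s x)%:E).
  apply: eq_integrable (integrable_abse ig) => // x _ /=.
  by rewrite normrM (ger0_norm (p0 _)).
have ib : mu.-integrable setT (fun x : R => (b x * normal_pdf m s x)%:E).
  apply: eq_integrable (integrableD _ ia ig) => // x _ /=.
  by rewrite -EFinD -mulrDl.
have iaX := ge0_integrable_transfer a0 ma ia.
have ibX := ge0_integrable_transfer b0 mb ib.
have gE : g = b \- a by apply/funext => x; rewrite /a /b /= addrC addKr.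
split.
  apply: eq_integrable (integrableB _ ibX iaX) => // x _ /=.
  by rewrite -EFinB /a /b addrC addKr.
have -> : \int[P]_w g (X w) = \int[P]_w (b (X w) - a (X w)).
  by rewrite {1}gE.
have -> : \int[mu]_x (g x * normal_pdf m s x) =
   \int[mu]_x (b x * normal_pdf m s x - a x * normal_pdf m s x).
  by apply: eq_Rintegral => x _; rewrite {1}gE /= mulrBl.
rewrite !RintegralB//; congr (_ - _); congr fine; exact: ge0_transfer.
Qed.

Hypothesis s0 : s != 0.

Lemma normal_central_moments :
  [/\ P.-integrable setT (fun w => (X w - m)%:E),
      P.-integrable setT (fun w => ((X w - m) ^+ 2)%:E)
    & P.-integrable setT (fun w => ((X w - m) ^+ 4)%:E)] /\
  [/\ \int[P]_w (X w - m) = 0, \int[P]_w (X w - m) ^+ 2 = s ^+ 2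
    & \int[P]_w (X w - m) ^+ 4 = 3 * s ^+ 4].
Proof.
have T k : (k <= 4)%N -> P.-integrable setT (fun w => ((X w - m) ^+ k)%:E) /\
    \int[P]_w (X w - m) ^+ k = \int[mu]_x ((x - m) ^+ k * normal_pdf m s x).
  move=> k4; apply: (@normal_transfer (fun x => (x - m) ^+ k)).
    by apply: measurable_funX; exact: measurable_funB.
  exact: integrable_normal_moment.
have c0 : (\int[mu]_x ((x - m) ^+ 0 * normal_pdf m s x)%:E = 1)%E.
  by under eq_integral do rewrite expr0 mul1r; exact: integral_normal_pdf.
have c1 : \int[mu]_x ((x - m) ^+ 1 * normal_pdf m s x) = 0.
  by rewrite /Rintegral normal_moment_rec// mulr0 mul0e.
have c2' := normal_moment_rec m (k := 1) s0 isT.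
have c4' := normal_moment_rec m (k := 3) s0 isT.
have [I1 E1] := T 1%N isT; have [I2 E2] := T 2%N isT; have [I4 E4] := T 4%N isT.
split; first by split=> //; apply: eq_integrable I1 => // x _; rewrite expr1.
split.
- by rewrite -c1 -E1; apply: eq_Rintegral => x _; rewrite expr1.
- by rewrite E2 /Rintegral c2' c0 mulr1 mule1.
- rewrite E4 /Rintegral c4' c2' c0 mulr1 mule1 -EFinM /=.
  by rewrite -mulrA mulrCA -exprD.
Qed.

End Density.

(** Stated in terms of the variance instead of the parameters of the law, so as
    to cover the degenerate laws: a centered Dirac mass has both moments 0. *)
Lemma gaussian_moment4 (X : Omega -> R) :
  is_gaussian P X -> \int[P]_w X w = 0 ->
  P.-integrable setT (fun w => (X w ^+ 4)%:E) /\
  \int[P]_w (X w ^+ 4) = 3 * (\int[P]_w (X w ^+ 2)) ^+ 2.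
Proof.
move=> [mX [m [s law]]] EX.
have mXk k : measurable_fun [set: Omega] (fun w => (X w ^+ k)%:E).
  by apply/measurable_EFinP; exact: measurable_funX.
have intc (c : R) : \int[P]_w (cst c) w = c.
  by rewrite Rintegral_cst//= probability_setT mulr1.
rewrite /gaussian_law in law; have [s0|s0] := eqVneq s 0; last first.
  have law' (A : set R) : measurable A -> P (X @^-1` A) = normal_prob m s A.
    by move=> mA; rewrite law// (negbTE s0).
  have [[I1 I2 I4] [E1 E2 E4]] := normal_central_moments mX law' s0.
  have m0 : m = 0.
    have : \int[P]_w (X w) = \int[P]_w ((X w - m) + cst m w).
      by apply: eq_Rintegral => w _; rewrite /= subrK.
    rewrite EX RintegralD//; last exact: finite_measure_integrable_cst.
    by rewrite E1 intc add0r => <-.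
  rewrite m0 in I4 E2 E4; split.
    by apply: eq_integrable I4 => // w _; rewrite subr0.
  rewrite (_ : \int[P]_w X w ^+ 4 = 3 * s ^+ 4); last first.
    by rewrite -E4; apply: eq_Rintegral => w _; rewrite subr0.
  rewrite (_ : \int[P]_w X w ^+ 2 = s ^+ 2); last first.
    by rewrite -E2; apply: eq_Rintegral => w _; rewrite subr0.
  by rewrite -exprM.
have Pm : P (X @^-1` [set m]) = 1%E.
  by rewrite law// s0 eqxx diracE mem_set.
have mm : measurable (X @^-1` [set m]) by rewrite -[X in measurable X]setTI; exact: mX.
have aem : {ae P, forall w, X w = m}.
  exists (~` (X @^-1` [set m])); split => //; first exact: measurableC.
  by rewrite probability_setC// Pm subee.
have aek k : \int[P]_w (X w ^+ k) = m ^+ k.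
  rewrite -[RHS]intc; congr fine; apply: ae_eq_integral => //.
    exact/measurable_EFinP.
  by apply: filterS aem => w -> _.
have m0 : m = 0 by rewrite -(expr1 m) -aek -EX; apply: eq_Rintegral => w _; rewrite expr1.
split; last by rewrite !aek m0 !expr0n/= mulr0.
apply/integrableP; split => //.
rewrite (_ : integral _ _ _ = 0)%E ?ltry//.
rewrite -(integral0 P setT); apply: ae_eq_integral => //.
  exact: measurableT_comp.
by apply: filterS aem => w -> _; rewrite m0 /= expr0n /= normr0.
Qed.

End Transfer.

(** * Gaussian spaces and Isserlis' formula *)

Section Expectation.
Context {R : realType} {disp : measure_display} {Omega : measurableType disp}.
Variable P : probability Omega R.
Implicit Types X Y : Omega -> R.

Definition L1 X : Prop := P.-integrable setT (fun w => (X w)%:E).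

Lemma L1_cst (c : R) : L1 (fun=> c).
Proof. exact: finite_measure_integrable_cst. Qed.

Lemma L1D X Y : L1 X -> L1 Y -> L1 (fun w => X w + Y w).
Proof.
by move=> iX iY; apply: eq_integrable (integrableD _ iX iY).
Qed.

Lemma L1Z (c : R) X : L1 X -> L1 (fun w => c * X w).
Proof.
by move=> iX; apply: eq_integrable (integrableZl _ c iX).
Qed.

Lemma L1_sum N (X : 'I_N -> Omega -> R) : (forall i, L1 (X i)) ->
  L1 (fun w => \sum_i X i w).
Proof.
move=> iX; apply: eq_integrable (integrable_sum measurableT _ (fun i _ => iX i)) => //.
by move=> w _; rewrite sumEFin.
Qed.

Lemma L1_le X Y : measurable_fun setT X -> (forall w, `|X w| <= Y w) -> L1 Y -> L1 X.
Proof.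
move=> mX XY iY; apply: le_integrable iY => //; first exact/measurable_EFinP.
by move=> w _ /=; rewrite lee_fin (le_trans (XY w))// ler_norm.
Qed.

Lemma E_cst (c : R) : \int[P]_w (fun=> c) w = c.
Proof. by rewrite Rintegral_cst//= probability_setT mulr1. Qed.

Lemma E_D X Y : L1 X -> L1 Y -> \int[P]_w (X w + Y w) = \int[P]_w X w + \int[P]_w Y w.
Proof. by move=> iX iY; rewrite RintegralD. Qed.

Lemma E_Z (c : R) X : L1 X -> \int[P]_w (c * X w) = c * \int[P]_w X w.
Proof. by move=> iX; rewrite RintegralZl. Qed.

Lemma E_sum N (X : 'I_N -> Omega -> R) : (forall i, L1 (X i)) ->
  \int[P]_w (\sum_i X i w) = \sum_i \int[P]_w X i w.
Proof.
elim: N X => [|N IH] X iX.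
  rewrite big_ord0; under eq_Rintegral do rewrite big_ord0.
  exact: E_cst.
under eq_Rintegral do rewrite big_ord_recl.
rewrite E_D//; last by apply: L1_sum => i; exact: iX.
by rewrite big_ord_recl IH.
Qed.

Lemma E_le X Y : L1 X -> L1 Y -> (forall w, X w <= Y w) ->
  \int[P]_w X w <= \int[P]_w Y w.
Proof. by move=> iX iY XY; apply: le_Rintegral. Qed.

(** A linear space of centered Gaussian variables; the elements are then
    automatically jointly Gaussian. *)
Definition gaussian_space (G : (Omega -> R) -> Prop) : Prop :=
  [/\ forall X, G X -> is_gaussian P X,
      forall X, G X -> \int[P]_w X w = 0,
      forall X Y, G X -> G Y -> G (fun w => X w + Y w)
    & forall (c : R) X, G X -> G (fun w => c * X w)].

Definition cov X Y : R := \int[P]_w (X w * Y w).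

Lemma covC X Y : cov X Y = cov Y X.
Proof. by apply: eq_Rintegral => w _; rewrite mulrC. Qed.

Section GaussianSpace.
Variable G : (Omega -> R) -> Prop.
Hypothesis hG : gaussian_space G.

Lemma gs_measurable X : G X -> measurable_fun setT X.
Proof. by case: hG => h _ _ _ /h[]. Qed.

(** Constants and fourth powers dominate all the products of two or four
    variables that occur below, so this settles their integrability. *)
Lemma gs_L1_pow4 X : G X -> L1 (fun w => X w ^+ 4).
Proof. by case: hG => h h0 _ _ GX; case: (gaussian_moment4 (h _ GX) (h0 _ GX)). Qed.

Lemma gs_L1_mul X Y : G X -> G Y -> L1 (fun w => X w * Y w).
Proof.
move=> GX GY.
apply: (L1_le _ _ (L1D (L1_cst 2) (L1D (gs_L1_pow4 GX) (gs_L1_pow4 GY)))).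
  by apply: measurable_funM; exact: gs_measurable.
move=> w; set x := X w; set y := Y w.
have h : x * y <= 2 + (x ^+ 4 + y ^+ 4).
  have := sqr_ge0 (x - y); have := sqr_ge0 (x ^+ 2 - 1); have := sqr_ge0 (y ^+ 2 - 1).
  have := sqr_ge0 x; have := sqr_ge0 y; nra.
have h' : - (x * y) <= 2 + (x ^+ 4 + y ^+ 4).
  have := sqr_ge0 (x + y); have := sqr_ge0 (x ^+ 2 - 1); have := sqr_ge0 (y ^+ 2 - 1).
  have := sqr_ge0 x; have := sqr_ge0 y; nra.
by rewrite ler_norml h andbT; lra.
Qed.

Lemma gs_L1_sqr_mul_sqr X Y : G X -> G Y -> L1 (fun w => X w ^+ 2 * Y w ^+ 2).
Proof.
move=> GX GY.
apply: (L1_le _ _ (L1D (gs_L1_pow4 GX) (gs_L1_pow4 GY))).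
  by apply: measurable_funM; apply: measurable_funX; exact: gs_measurable.
move=> w; set x := X w; set y := Y w.
rewrite ger0_norm; last by rewrite mulr_ge0 ?sqr_ge0.
have := sqr_ge0 (x ^+ 2 - y ^+ 2); have := sqr_ge0 (x ^+ 2); have := sqr_ge0 (y ^+ 2).
nra.
Qed.

Lemma gs_L1_sqr X : G X -> L1 (fun w => X w ^+ 2).
Proof. by move=> GX; apply: eq_integrable (gs_L1_mul GX GX) => // w _; rewrite expr2. Qed.

Lemma cov_sqr X : cov X X = \int[P]_w (X w ^+ 2).
Proof. by apply: eq_Rintegral => w _; rewrite expr2. Qed.

Lemma cov_ge0 X : 0 <= cov X X.
Proof. by apply: Rintegral_ge0 => w _; rewrite -expr2 sqr_ge0. Qed.

Lemma gs_add X Y : G X -> G Y -> G (fun w => X w + Y w).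
Proof. by case: hG => _ _ h _; exact: h. Qed.

Lemma gs_scale (c : R) X : G X -> G (fun w => c * X w).
Proof. by case: hG => _ _ _ h; exact: h. Qed.

Lemma covDr X Y Z : G X -> G Y -> G Z ->
  cov X (fun w => Y w + Z w) = cov X Y + cov X Z.
Proof.
move=> GX GY GZ; rewrite /cov -E_D; [|exact: gs_L1_mul..].
by apply: eq_Rintegral => w _; rewrite mulrDr.
Qed.

Lemma covZr (c : R) X Y : G X -> G Y -> cov X (fun w => c * Y w) = c * cov X Y.
Proof.
move=> GX GY; rewrite /cov -E_Z; last exact: gs_L1_mul.
by apply: eq_Rintegral => w _; rewrite mulrCA.
Qed.

Lemma covDl X Y Z : G X -> G Y -> G Z ->
  cov (fun w => Y w + Z w) X = cov Y X + cov Z X.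
Proof. by move=> GX GY GZ; rewrite covC covDr// !(covC X). Qed.

Lemma covZl (c : R) X Y : G X -> G Y -> cov (fun w => c * Y w) X = c * cov Y X.
Proof. by move=> GX GY; rewrite covC covZr// covC. Qed.

Lemma gs_moment4 X : G X -> \int[P]_w (X w ^+ 4) = 3 * cov X X ^+ 2.
Proof.
case: hG => h h0 _ _ GX; case: (gaussian_moment4 (h _ GX) (h0 _ GX)) => _ ->.
by rewrite cov_sqr.
Qed.

(** Isserlis' formula, by polarization of the fourth moments of X + Y and X - Y. *)
Lemma isserlis X Y : G X -> G Y ->
  \int[P]_w (X w ^+ 2 * Y w ^+ 2) = cov X X * cov Y Y + 2 * cov X Y ^+ 2.
Proof.
move=> GX GY.
pose D w := X w + 1 * Y w; pose S w := X w + (-1) * Y w.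
have GD1 : G D by apply: gs_add => //; exact: gs_scale.
have GS1 : G S by apply: gs_add => //; exact: gs_scale.
have E1 : \int[P]_w (D w ^+ 4 + S w ^+ 4) =
  \int[P]_w (12 * (X w ^+ 2 * Y w ^+ 2) + (2 * X w ^+ 4 + 2 * Y w ^+ 4)).
  apply: eq_Rintegral => w _; rewrite /D /S; ring.
have := E1; rewrite !E_D ?E_Z; last first.
  all: try (by repeat first [exact: gs_L1_pow4|exact: gs_L1_sqr_mul_sqr|apply: L1D|apply: L1Z]).
have cD : cov D D = cov X X + 2 * cov X Y + cov Y Y.
  rewrite /D; have G1 := gs_scale 1 GY.
  rewrite covDl ?gs_add// !covDr// !covZl// !covZr// (covC Y X); ring.
have cS : cov S S = cov X X - 2 * cov X Y + cov Y Y.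
  rewrite /S; have G1 := gs_scale (-1) GY.
  rewrite covDl ?gs_add// !covDr// !covZl// !covZr// (covC Y X); ring.
rewrite !gs_moment4// cD cS; nra.
Qed.

(** By Isserlis' formula the product of the variances cancels against the
    centering, and only the squared covariances are left. *)
Lemma E_sqr_sum_centered_sqr N (X : 'I_N -> Omega -> R) (v : R) :
  (forall i, G (X i)) -> (forall i, cov (X i) (X i) = v) ->
  L1 (fun w => (\sum_i (X i w ^+ 2 - v)) ^+ 2) /\
  \int[P]_w (\sum_i (X i w ^+ 2 - v)) ^+ 2 = \sum_i \sum_j 2 * cov (X i) (X j) ^+ 2.
Proof.
move=> GX vX.
pose F i j w := X i w ^+ 2 * X j w ^+ 2 + ((- v) * X i w ^+ 2 + ((- v) * X j w ^+ 2 + v ^+ 2)).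
have FE w : (\sum_i (X i w ^+ 2 - v)) ^+ 2 = \sum_i \sum_j F i j w.
  rewrite expr2 big_distrl; apply: eq_bigr => i _ /=.
  rewrite big_distrr; apply: eq_bigr => j _ /=; rewrite /F; ring.
have iF i j : L1 (F i j).
  apply: L1D; first exact: gs_L1_sqr_mul_sqr.
  apply: L1D; first by apply: L1Z; exact: gs_L1_sqr.
  by apply: L1D; [apply: L1Z; exact: gs_L1_sqr|exact: L1_cst].
split.
  rewrite (_ : (fun w => _) = fun w => \sum_i \sum_j F i j w); last by apply/funext.
  by apply: L1_sum => i; exact: L1_sum.
under eq_Rintegral do rewrite FE.
rewrite E_sum; last by move=> i; exact: L1_sum.
apply: eq_bigr => i _; rewrite E_sum//; apply: eq_bigr => j _.
have s i' := gs_L1_sqr (GX i').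
have sv i' := L1Z (- v) (s i').
have c2 := L1_cst (v ^+ 2).
rewrite /F E_D ?E_D ?E_Z ?E_cst ?isserlis -?cov_sqr ?vX//; [ring|..].
- exact: L1_cst.
- exact: L1D.
- exact: gs_L1_sqr_mul_sqr.
- by apply: L1D => //; exact: L1D.
Qed.

Lemma normr_cov_le (v : R) X Y : G X -> G Y -> cov X X = v -> cov Y Y = v ->
  `|cov X Y| <= v.
Proof.
move=> GX GY vX vY.
have G1 := gs_scale (-1) GY.
have h1 := cov_ge0 (fun w => X w + Y w).
have h2 := cov_ge0 (fun w => X w + (-1) * Y w).
have G2 := gs_add GX GY; have G3 := gs_add GX G1.
rewrite covDl// !covDr// (covC Y X) vX vY in h1.
rewrite covDl// !covDr// !covZl// !covZr// (covC Y X) vX vY in h2.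
by rewrite ler_norml; apply/andP; split; lra.
Qed.

(** |S| <= (lam + S^2 / lam) / 2 avoids the Cauchy-Schwarz inequality, and
    cov^2 <= v |cov| makes the variance linear in the absolute covariances. *)
Lemma E_norm_sum_centered_sqr N (X : 'I_N -> Omega -> R) (v A lam : R) :
  (forall i, G (X i)) -> (forall i, cov (X i) (X i) = v) ->
  \sum_i \sum_j `|cov (X i) (X j)| <= A -> 0 <= v -> 0 < lam ->
  2 * v * A <= lam ^+ 2 ->
  L1 (fun w => `|\sum_i (X i w ^+ 2 - v)|) /\
  \int[P]_w `|\sum_i (X i w ^+ 2 - v)| <= lam.
Proof.
move=> GX vX hA v0 lam0 hlam.
have [iS ES] := E_sqr_sum_centered_sqr GX vX.
set S := fun w => \sum_i (X i w ^+ 2 - v) in iS ES *.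
have mS : measurable_fun setT S.
  apply: measurable_sum => i; apply: measurable_funB => //.
  by apply: measurable_funX; exact: gs_measurable.
pose T w := 2^-1 * lam + (2 * lam)^-1 * S w ^+ 2.
have iT : L1 T by apply: L1D; [exact: L1_cst|exact: L1Z].
have ST w : `|S w| <= T w.
  have := sqr_ge0 (lam - `|S w|); rewrite sqrrB real_normK ?num_real// => h.
  rewrite /T -(ler_pM2l (_ : 0 < 2 * lam)) ?mulr_gt0//.
  have -> : 2 * lam * (2^-1 * lam + (2 * lam)^-1 * S w ^+ 2) = lam ^+ 2 + S w ^+ 2.
    by field; rewrite gt_eqF.
  move: h; rewrite -mulr_natl; lra.
have iN : L1 (fun w => `|S w|).
  apply: (L1_le _ _ iT); first exact: measurableT_comp.
  by move=> w; rewrite normr_id.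
split => //; apply: (le_trans (E_le iN iT ST)).
rewrite /T E_D; [|exact: L1_cst|exact: L1Z].
rewrite E_cst (E_Z _ iS).
have -> : \int[P]_w S w ^+ 2 = \sum_i \sum_j 2 * cov (X i) (X j) ^+ 2 by exact: ES.
have H : \sum_i \sum_j 2 * cov (X i) (X j) ^+ 2 <= lam ^+ 2.
  apply: (le_trans _ hlam); apply: (@le_trans _ _ (2 * v * \sum_i \sum_j `|cov (X i) (X j)|)).
    rewrite mulr_sumr; apply: ler_sum => i _; rewrite mulr_sumr; apply: ler_sum => j _.
    rewrite -mulrA ler_wpM2l// -[_ ^+ 2]real_normK ?num_real// expr2 ler_wpM2r//.
    exact: normr_cov_le.
  by rewrite ler_wpM2l// mulr_ge0.
rewrite -(ler_pM2l (_ : 0 < 2 * lam)) ?mulr_gt0//.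
set Q := \sum_i _ in H *.
have -> : 2 * lam * (2^-1 * lam + (2 * lam)^-1 * Q) = lam ^+ 2 + Q.
  by field; rewrite gt_eqF.
lra.
Qed.

End GaussianSpace.
End Expectation.

(** * Covariances of the increments of fractional Brownian motion *)

Section PowerFunctions.
Context {R : realType}.
Implicit Types (p x y r : R).

Lemma powR_midpoint_convex p x y : 1 <= p -> 0 <= x -> 0 <= y ->
  ((x + y) / 2) `^ p <= (x `^ p + y `^ p) / 2.
Proof.
move=> p1 x0 y0.
have := convex_powR p1 (Itv01 (_ : 0 <= 2^-1) (_ : 2^-1 <= 1)) (x := x) (y := y).
rewrite !inE /= !in_itv /= !andbT => H.
have h0 : (0 : R) <= 2^-1 by rewrite invr_ge0.
have h1 : (2^-1 : R) <= 1 by lra.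
move: (H h0 h1 x0 y0) => {}H; rewrite convRE [X in X `^ _ <= _]convRE /= in H.
move: H.
have -> : unstable.onem (2^-1 : R) = 2^-1 by rewrite /unstable.onem; field.
by rewrite -!mulrDr ![2^-1 * _]mulrC.
Qed.

(** Midpoint convexity of the inverse power 1 / p, at x^p and y^p. *)
Lemma powR_midpoint_concave p x y : 0 < p <= 1 -> 0 <= x -> 0 <= y ->
  (x `^ p + y `^ p) / 2 <= ((x + y) / 2) `^ p.
Proof.
move=> /andP[p0 p1] x0 y0.
have ip1 : 1 <= p^-1 by rewrite invf_ge1.
have pK (z : R) : 0 <= z -> (z `^ p) `^ p^-1 = z.
  by move=> z0; rewrite -powRrM mulfV ?gt_eqF// powRr1.
have pK' (z : R) : 0 <= z -> (z `^ p^-1) `^ p = z.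
  by move=> z0; rewrite -powRrM mulVf ?gt_eqF// powRr1.
have := powR_midpoint_convex ip1 (powR_ge0 x p) (powR_ge0 y p).
rewrite !pK// => H.
rewrite -[leLHS]pK'; last by rewrite divr_ge0// addr_ge0// powR_ge0.
apply: ge0_ler_powR => //; first exact: ltW.
  by rewrite nnegrE powR_ge0.
by rewrite nnegrE divr_ge0// addr_ge0.
Qed.

End PowerFunctions.

Section Increments.
Context {R : realType}.

(** The covariance of the increments of fractional Brownian motion over
    [i, i+1] and [j, j+1]. *)
Definition fgn_cov (p : R) (i j : nat) : R :=
  let c (x y : R) := `|x - y| `^ p in
  2^-1 * (c i.+1%:R j%:R + c i%:R j.+1%:R - 2 * c i%:R j%:R).

Lemma fgn_covC p i j : fgn_cov p i j = fgn_cov p j i.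
Proof.
rewrite /fgn_cov /= (distrC i.+1%:R) (distrC i%:R j.+1%:R) (distrC i%:R j%:R); ring.
Qed.

Lemma fgn_cov_diag p i : p != 0 -> fgn_cov p i i = 1.
Proof.
move=> p0; rewrite /fgn_cov /= subrr normr0 powR0// -(@natr1 R i).
have -> : i%:R + 1 - i%:R = 1 :> R by ring.
have -> : i%:R - (i%:R + 1) = - 1 :> R by ring.
by rewrite normrN normr1 powR1; field.
Qed.

Lemma fgn_cov_ltn p i j : (j < i)%N -> exists2 r : R, 1 <= r &
  fgn_cov p i j = ((r + 1) `^ p + (r - 1) `^ p) / 2 - r `^ p.
Proof.
move=> ji; exists (i%:R - j%:R).
  by rewrite lerBrDr addrC natr1 ler_nat.
have d : j.+1%:R <= i%:R :> R by rewrite ler_nat.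
have e (k : nat) : k.+1%:R = k%:R + 1 :> R by rewrite natr1.
rewrite !e in d *; rewrite /fgn_cov /= !e.
rewrite !ger0_norm; [|lra|lra|lra].
have -> : i%:R + 1 - j%:R = i%:R - j%:R + 1 :> R by ring.
have -> : i%:R - (j%:R + 1) = i%:R - j%:R - 1 :> R by ring.
by field.
Qed.

Lemma fgn_cov_ge0 p i j : 1 <= p -> 0 <= fgn_cov p i j.
Proof.
move=> p1; have p0 : p != 0 by rewrite gt_eqF//; lra.
wlog ji : i j / (j <= i)%N.
  by move=> W; case/orP: (leq_total j i) => h; [|rewrite fgn_covC]; exact: W.
have [->|ij] := eqVneq i j; first by rewrite fgn_cov_diag.
have [|r r1 ->] := @fgn_cov_ltn p i j; first by rewrite ltn_neqAle eq_sym ij.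
have := @powR_midpoint_convex R p (r + 1) (r - 1) p1.
have -> : (r + 1 + (r - 1)) / 2 = r by field.
by move=> H; rewrite subr_ge0; apply: H; lra.
Qed.

Lemma fgn_cov_le0 p i j : 0 < p <= 1 -> i != j -> fgn_cov p i j <= 0.
Proof.
move=> p1 ij.
wlog ji : i j ij / (j <= i)%N.
  by move=> W; case/orP: (leq_total j i) => h; [|rewrite fgn_covC]; apply: W => //; rewrite eq_sym.
have [|r r1 ->] := @fgn_cov_ltn p i j; first by rewrite ltn_neqAle eq_sym ij.
have := @powR_midpoint_concave R p (r + 1) (r - 1) p1.
have -> : (r + 1 + (r - 1)) / 2 = r by field.
by move=> H; rewrite subr_le0; apply: H; lra.
Qed.

End Increments.

Section StationaryIncrements.
Context {R : realType} {disp : measure_display} {Omega : measurableType disp}.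
Variables (P : probability Omega R) (G : (Omega -> R) -> Prop).
Hypothesis hG : gaussian_space P G.
Variables (T H nu : R) (Z : R -> Omega -> R).
Hypothesis H01 : 0 < H < 1.
Hypothesis nu0 : 0 <= nu.
Hypothesis GZ : forall t, 0 <= t <= T -> G (Z t).
Hypothesis covZ : forall s t, 0 <= s <= T -> 0 <= t <= T ->
  cov P (Z s) (Z t) =
  nu * (2^-1 * (t `^ (2 * H) + s `^ (2 * H) - `|t - s| `^ (2 * H))).

Definition dZ (s t : R) (w : Omega) : R := Z t w + (-1) * Z s w.

Lemma dZ_gs s t : 0 <= s <= T -> 0 <= t <= T -> G (dZ s t).
Proof.
by move=> hs ht; apply: (gs_add hG); [|apply: (gs_scale hG)]; exact: GZ.
Qed.

Lemma cov_dZ a b c d : 0 <= a <= T -> 0 <= b <= T -> 0 <= c <= T -> 0 <= d <= T ->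
  cov P (dZ a b) (dZ c d) =
  nu * (2^-1 * (`|b - c| `^ (2 * H) + `|a - d| `^ (2 * H)
                - `|b - d| `^ (2 * H) - `|a - c| `^ (2 * H))).
Proof.
move=> ha hb hc hd.
have Ga := GZ ha; have Gb := GZ hb; have Gc := GZ hc; have Gd := GZ hd.
have Gma := gs_scale hG (-1) Ga; have Gmc := gs_scale hG (-1) Gc.
have Gcd := dZ_gs hc hd.
rewrite /dZ (covDl hG)// (covZl hG)// !(covDr hG)// !(covZr hG)// !covZ//.
rewrite (distrC d b) (distrC c b) (distrC d a) (distrC c a).
ring.
Qed.

Section Block.
Variables (a D : R) (N : nat).
Hypothesis a0 : 0 <= a.
Hypothesis D0 : 0 < D.
Hypothesis aT : a + N%:R * D <= T.
Hypothesis N0 : (0 < N)%N.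

Let X (i : nat) : Omega -> R := dZ (a + i%:R * D) (a + i.+1%:R * D).

Let inT (i : nat) : (i <= N)%N -> 0 <= a + i%:R * D <= T.
Proof.
move=> iN; apply/andP; split; first by rewrite addr_ge0// mulr_ge0// ltW.
by apply: le_trans aT; rewrite lerD2l ler_pM2r// ler_nat.
Qed.

Lemma cov_increments i j : (i < N)%N -> (j < N)%N ->
  cov P (X i) (X j) = nu * D `^ (2 * H) * fgn_cov (2 * H) i j.
Proof.
move=> iN jN; rewrite cov_dZ; [|exact/inT/ltnW|exact: inT|exact/inT/ltnW|exact: inT].
have E (x y : R) : `|a + x * D - (a + y * D)| `^ (2 * H) = `|x - y| `^ (2 * H) * D `^ (2 * H).
  have -> : a + x * D - (a + y * D) = (x - y) * D by ring.
  by rewrite normrM (gtr0_norm D0) powRM// ltW.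
rewrite !E /fgn_cov /=.
have -> : i.+1%:R - j.+1%:R = i%:R - j%:R :> R.
  by rewrite -(@natr1 R i) -(@natr1 R j); ring.
by ring.
Qed.

Let p0 : 0 < 2 * H. Proof. by case/andP: H01 => h _; lra. Qed.

(** The increments add up to the increment over the whole block, of length N D. *)
Lemma sum_cov_increments :
  \sum_(i < N) \sum_(j < N) cov P (X i) (X j) = nu * D `^ (2 * H) * N%:R `^ (2 * H).
Proof.
have GX (i : 'I_N) : G (X i) by apply: dZ_gs; [exact/inT/ltnW|exact: inT].
have iXX (i j : 'I_N) : L1 P (fun w => X i w * X j w) by exact: (gs_L1_mul hG).
under eq_bigr => i _ do rewrite -E_sum//.
rewrite -E_sum; last by move=> i; exact: L1_sum.
have tel w : \sum_(i < N) X i w = dZ a (a + N%:R * D) w.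
  rewrite /X /dZ -(big_mkord xpredT (fun i => Z (a + i.+1%:R * D) w + (-1) * Z (a + i%:R * D) w)).
  under eq_bigr do rewrite mulN1r.
  by rewrite telescope_sumr// mul0r addr0 mulN1r.
have -> : \int[P]_w (\sum_(i < N) \sum_(j < N) X i w * X j w) =
  cov P (dZ a (a + N%:R * D)) (dZ a (a + N%:R * D)).
  apply: eq_Rintegral => w _; rewrite -tel big_distrl; apply: eq_bigr => i _ /=.
  by rewrite big_distrr.
have h0 : 0 <= a <= T by have := inT (leq0n N); rewrite mul0r addr0.
have hN := inT (leqnn N).
have ND : 0 <= N%:R * D by rewrite mulr_ge0// ltW.
rewrite cov_dZ// !subrr normr0 powR0 ?gt_eqF//.
have -> : a + N%:R * D - a = N%:R * D by ring.
have -> : a - (a + N%:R * D) = - (N%:R * D) by ring.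
rewrite normrN ger0_norm// powRM// ?(ltW D0)//; by field.
Qed.

(** For H >= 1/2 no covariance is negative, and the absolute values can be
    dropped. For H <= 1/2 only the diagonal ones are positive; the total, being a
    variance, is nonnegative, so the absolute values outside the diagonal add up
    to at most the diagonal. *)
Lemma sum_norm_cov_increments :
  \sum_(i < N) \sum_(j < N) `|cov P (X i) (X j)| <=
  2 * nu * D `^ (2 * H) * N%:R `^ (2 * Num.max H 2^-1).
Proof.
set v := nu * D `^ (2 * H); have v0 : 0 <= v by rewrite mulr_ge0// powR_ge0.
have [h|h] := leP 1 (2 * H).
  rewrite (_ : Num.max _ _ = H); last by apply/max_idPl; lra.
  under eq_bigr => i _.
    under eq_bigr => j _.
      rewrite ger0_norm; last by rewrite cov_increments// mulr_ge0// fgn_cov_ge0.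
      over.
    over.
  rewrite /= sum_cov_increments -/v -(mulrA 2 nu) -/v.
  by apply: ler_wpM2r; [exact: powR_ge0|lra].
rewrite (_ : Num.max _ _ = 2^-1); last by apply/max_idPr; lra.
have -> : N%:R `^ (2 * 2^-1) = N%:R :> R by rewrite mulfV// powRr1// ler0n.
apply: (@le_trans _ _ (\sum_(i < N) \sum_(j < N) (2 * v * (i == j)%:R - cov P (X i) (X j)))).
  apply: ler_sum => i _; apply: ler_sum => j _.
  rewrite cov_increments// -/v; have [->|ij] := eqVneq i j.
    by rewrite fgn_cov_diag ?gt_eqF// !mulr1 ger0_norm//; lra.
  rewrite mulr0 sub0r ler0_norm// mulr_ge0_le0//.
  by apply: fgn_cov_le0 => //; apply/andP; split => //; exact: ltW.
under eq_bigr => i _.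
  rewrite sumrB (bigD1 i)//= eqxx mulr1 big1 ?addr0; last first.
    by move=> j ji; rewrite eq_sym (negbTE ji) mulr0.
  over.
rewrite sumrB sum_cov_increments -/v sumr_const card_ord -[(2 * v) *+ N]mulr_natr.
by rewrite -(mulrA 2 nu) -/v lerBlDr lerDl mulr_ge0// powR_ge0.
Qed.

(** The factor N^max(H, 1/2) instead of N is the gain from averaging. *)
Lemma E_norm_block :
  L1 P (fun w => `|\sum_(i < N) (X i w ^+ 2 - nu * D `^ (2 * H))|) /\
  \int[P]_w `|\sum_(i < N) (X i w ^+ 2 - nu * D `^ (2 * H))| <=
  2 * (nu + 1) * D `^ (2 * H) * N%:R `^ (Num.max H 2^-1).
Proof.
have GX (i : 'I_N) : G (X i) by apply: dZ_gs; [exact/inT/ltnW|exact: inT].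
have Dp : 0 < D `^ (2 * H) by exact: powR_gt0.
have Np : 0 < N%:R `^ (Num.max H 2^-1) by apply: powR_gt0; rewrite ltr0n.
apply: (@E_norm_sum_centered_sqr _ _ _ P G hG N X _
  (2 * nu * D `^ (2 * H) * N%:R `^ (2 * Num.max H 2^-1))).
- exact: GX.
- by move=> i; rewrite cov_increments// fgn_cov_diag ?gt_eqF// mulr1.
- exact: sum_norm_cov_increments.
- by rewrite mulr_ge0// ltW.
- apply: mulr_gt0 => //; apply: mulr_gt0 => //; move: nu0; lra.
have -> : N%:R `^ (2 * Num.max H 2^-1) = (N%:R `^ Num.max H 2^-1) ^+ 2 :> R.
  by rewrite mulrC powRrM -powR_mulrn// powR_ge0.
set x := D `^ _; set y := N%:R `^ _.
have -> : 2 * (nu * x) * (2 * nu * x * y ^+ 2) = nu ^+ 2 * (4 * x ^+ 2 * y ^+ 2) by ring.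
have -> : (2 * (nu + 1) * x * y) ^+ 2 = (nu + 1) ^+ 2 * (4 * x ^+ 2 * y ^+ 2) by ring.
apply: ler_wpM2r; first by rewrite -mulrA -exprMn mulr_ge0// sqr_ge0.
by move: nu0 => h; nra.
Qed.

End Block.

End StationaryIncrements.

(** * Almost sure bounds for block sums of squared increments *)

Section PowersOfTwo.
Context {R : realType}.
Implicit Types x y : R.

Lemma pow2_gt0 x : 0 < 2 `^ x :> R.
Proof. exact: powR_gt0. Qed.

Lemma pow2D x y : 2 `^ (x + y) = 2 `^ x * 2 `^ y :> R.
Proof. by rewrite powRD// pnatr_eq0 implybT. Qed.

Lemma ler_pow2 x y : (2 `^ x <= 2 `^ y :> R) = (x <= y).
Proof.
by rewrite /powR pnatr_eq0 /= ler_expR ler_pM2r// ln_gt0// ltr1n.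
Qed.

Lemma ltr_pow2 x y : (2 `^ x < 2 `^ y :> R) = (x < y).
Proof. by rewrite !ltNge ler_pow2. Qed.

Lemma pow2_nat n : 2 `^ n%:R = 2 ^+ n :> R.
Proof. exact: powR_mulrn. Qed.

Lemma pow2_Nnat n : 2 `^ (- n%:R) = 2 ^- n :> R.
Proof. by rewrite powRN pow2_nat. Qed.

Lemma pow2M x y : (2 `^ x) `^ y = 2 `^ (x * y) :> R.
Proof. by rewrite powRrM. Qed.

End PowersOfTwo.

Section SummableExpectations.
Context {R : realType} {disp : measure_display} {Omega : measurableType disp}.
Variable P : probability Omega R.

Lemma geometric_partial_sum (r : R) (n : nat) : 0 <= r < 1 ->
  \sum_(i < n) r ^+ i <= (1 - r)^-1.
Proof.
move=> /andP[r0 r1]; have d : 0 < 1 - r by lra.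
rewrite -(ler_pM2l d) mulfV ?gt_eqF// -opprB mulNr -subrX1 opprB.
by rewrite gerBl exprn_ge0.
Qed.

(** A Borel-Cantelli argument: the series of the V n has a finite expectation,
    so it converges almost surely. *)
Lemma ae_bounded_of_geometric (V : nat -> Omega -> R) (C r : R) :
  (forall n, L1 P (V n)) -> (forall n w, 0 <= V n w) -> 0 <= C -> 0 <= r < 1 ->
  (forall n, \int[P]_w V n w <= C * r ^+ n) ->
  {ae P, forall w, exists D : R, forall n, V n w <= D}.
Proof.
move=> iV V0 C0 r01 EV.
pose f n w := (V n w)%:E.
have mf n : measurable_fun setT (f n) by exact: measurable_int (iV n).
have f0 n w : (0 <= f n w)%E by rewrite lee_fin.
pose g w := (\sum_(n <oo) f n w)%E.
have g0 w : (0 <= g w)%E by apply: nneseries_ge0.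
have mg : measurable_fun setT g by apply: ge0_emeasurable_sum.
have Ef n : (\int[P]_w f n w <= (C * r ^+ n)%:E)%E.
  rewrite -(fineK (integrable_fin_num _ (iV n)))//.
  exact: EV.
have Eg : (\int[P]_w g w <= (C * (1 - r)^-1)%:E)%E.
  rewrite integral_nneseries//; apply: lime_le.
    by apply: is_cvg_nneseries => n _ _; apply: integral_ge0.
  apply: nearW => n; rewrite big_mkord.
  apply: (@le_trans _ _ (\sum_(i < n) (C * r ^+ i)%:E)%E); first exact: lee_sum.
  rewrite sumEFin lee_fin -mulr_sumr ler_wpM2l//; exact: geometric_partial_sum.
have ig : P.-integrable setT g.
  apply/integrableP; split => //.
  under eq_integral => w _ do rewrite gee0_abs//.
  by apply: le_lt_trans Eg _; exact: ltry.
have := integrable_ae measurableT ig; apply: filterS => w /(_ I) gw.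
exists (fine (g w)) => n.
rewrite -lee_fin fineK//.
apply: (@le_trans _ _ (\sum_(0 <= i < n.+1) f i w)%E); last first.
  by apply: nneseries_lim_ge.
by rewrite big_nat_recr//= leeDr// sume_ge0.
Qed.

End SummableExpectations.

Section BlockError.
Context {R : realType}.

(** The term nu D is the expectation of the scaled square when the increments
    of x over intervals of length D have variance nu D^(2H). *)
Definition scaled_error (T H nu : R) (x : R -> R) (n i : nat) : R :=
  (T / 2 ^+ n) `^ (1 - 2 * H) * incr x (dyadic T n i) (dyadic T n i.+1) ^+ 2
  - nu * (T / 2 ^+ n).

Definition block_error (T H nu : R) (x : R -> R) (n m : nat) : R :=
  \sum_(j < 2 ^ m) `|\sum_(i < 2 ^ (n - m)) scaled_error T H nu x n (j * 2 ^ (n - m) + i)|.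

Context {disp : measure_display} {Omega : measurableType disp}.
Variables (P : probability Omega R) (G : (Omega -> R) -> Prop).
Hypothesis hG : gaussian_space P G.
Variables (T H nu : R) (Z : R -> Omega -> R).
Hypothesis T0 : 0 < T.
Hypothesis H01 : 0 < H < 1.
Hypothesis nu0 : 0 <= nu.
Hypothesis GZ : forall t, 0 <= t <= T -> G (Z t).
Hypothesis covZ : forall s t, 0 <= s <= T -> 0 <= t <= T ->
  cov P (Z s) (Z t) =
  nu * (2^-1 * (t `^ (2 * H) + s `^ (2 * H) - `|t - s| `^ (2 * H))).

Let h : R := Num.max H 2^-1.

(** There are 2^m blocks of 2^(n - m) intervals each; the power D^(2H) from
    [E_norm_block] is turned into D by the scaling, and 2^n D = T. *)
Lemma E_block_error n m : (m <= n)%N ->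
  L1 P (fun w => block_error T H nu (Z^~ w) n m) /\
  \int[P]_w block_error T H nu (Z^~ w) n m <=
  2 * (nu + 1) * T * (2 ^- (n - m)) `^ (1 - h).
Proof.
move=> mn; set D := T / 2 ^+ n; set N := (2 ^ (n - m))%N.
have D0 : 0 < D by rewrite divr_gt0// exprn_gt0.
have N0 : (0 < N)%N by rewrite expn_gt0.
have Dp : 0 < D `^ (1 - 2 * H) by exact: powR_gt0.
have DD : D `^ (1 - 2 * H) * D `^ (2 * H) = D.
  by rewrite -powRD subrK ?oner_eq0// powRr1// ltW.
have ND : (2 ^ m)%:R * N%:R * D = T.
  by rewrite -natrM -expnD subnKC// natrX /D; field; rewrite expf_neq0.
pose F (j : nat) w := `|\sum_(i < N)
  (dZ Z ((j * N)%:R * D + i%:R * D) ((j * N)%:R * D + i.+1%:R * D) w ^+ 2 - nu * D `^ (2 * H))|.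
have FE (j : nat) w : `|\sum_(i < N) scaled_error T H nu (Z^~ w) n (j * N + i)| = D `^ (1 - 2 * H) * F j w.
  rewrite /F -[D `^ _ in RHS]gtr0_norm// -normrM mulr_sumr; congr `| _ |.
  apply: eq_bigr => i _; rewrite /scaled_error -/D mulrBr; congr (_ - _).
    rewrite /dZ /incr mulN1r; congr (_ * (Z _ w - Z _ w) ^+ 2);
      rewrite /dyadic /D -?addnS natrD; ring.
  by rewrite [RHS]mulrCA DD.
have FB (j : 'I_(2 ^ m)) := @E_norm_block _ _ _ P G hG T H nu Z H01 nu0 GZ covZ ((j * N)%:R * D) D N.
have FB' (j : 'I_(2 ^ m)) : L1 P (F j) /\
   \int[P]_w F j w <= 2 * (nu + 1) * D `^ (2 * H) * N%:R `^ h.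
  apply: FB => //; first by rewrite mulr_ge0// ltW.
  rewrite -mulrDl -natrD -ND -natrM ler_pM2r// ler_nat -mulSnr leq_mul2r.
  by rewrite ltn_ord orbT.
have BE w : block_error T H nu (Z^~ w) n m = \sum_(j < 2 ^ m) D `^ (1 - 2 * H) * F j w.
  by apply: eq_bigr => j _; exact: FE.
have iF (j : 'I_(2 ^ m)) : L1 P (fun w => D `^ (1 - 2 * H) * F j w).
  by apply: L1Z; case: (FB' j).
split; first by move: (L1_sum iF); rewrite -(funext BE).
under eq_Rintegral do rewrite BE.
rewrite E_sum//.
apply: (@le_trans _ _ (\sum_(j < 2 ^ m) 2 * (nu + 1) * D * N%:R `^ h)).
  apply: ler_sum => j _; have [i1 i2] := FB' j; rewrite E_Z//.
  apply: (le_trans (ler_wpM2l (ltW Dp) i2)).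
  rewrite [leLHS](_ : _ = 2 * (nu + 1) * (D `^ (1 - 2 * H) * D `^ (2 * H)) * N%:R `^ h).
    by rewrite DD.
  ring.
rewrite sumr_const card_ord -[_ *+ _]mulr_natr.
have -> : (2 ^- (n - m) : R) = N%:R^-1 by rewrite natrX.
have -> : T = (2 ^ m)%:R * N%:R * D by [].
have Np : (0 : R) < N%:R by rewrite ltr0n.
have {1}-> : N%:R `^ h = N%:R * (N%:R^-1) `^ (1 - h).
  rewrite -{2}[N%:R]powRr1 ?ler0n//.
  have -> : (N%:R^-1 : R) = N%:R `^ (-1) by rewrite powR_inv1// ler0n.
  rewrite -powRrM -powRD; last by rewrite (lt0r_neq0 Np) implybT.
  by congr (_ `^ _); ring.
by rewrite le_eqVlt; apply/orP; left; apply/eqP; ring.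
Qed.

(** Since n - m >= h n, the expected error is of order 2^(- h (1 - h) n), which
    remains summable after multiplication by 2^(q n). *)
Lemma ae_block_error (m : nat -> nat) (q : R) :
  (forall n, (m n)%:R <= (1 - h) * n%:R) -> q < h * (1 - h) ->
  {ae P, forall w, exists C : R, forall n,
     block_error T H nu (Z^~ w) n (m n) <= C * 2 `^ (- (q * n%:R))}.
Proof.
move=> hm hq.
have h01 : 0 < h < 1.
  by rewrite /h lt_max gt_max; case/andP: H01 => -> ->; rewrite /=; lra.
have mn n : (m n <= n)%N.
  rewrite -(ler_nat R); apply: (le_trans (hm n)).
  by rewrite ler_piMl//; lra.
pose r : R := 2 `^ (q - h * (1 - h)).
have r01 : 0 <= r < 1.
  by rewrite powR_ge0 -(powRr0 2) ltr_pow2 subr_lt0.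
pose V n w := 2 `^ (q * n%:R) * block_error T H nu (Z^~ w) n (m n).
have B0 n w : 0 <= block_error T H nu (Z^~ w) n (m n) by apply: sumr_ge0.
have hV : {ae P, forall w, exists D : R, forall n, V n w <= D}.
  apply: (@ae_bounded_of_geometric _ _ _ P V (2 * (nu + 1) * T) r) => //.
  - by move=> n; apply: L1Z; case: (E_block_error (mn n)).
  - by move=> n w; rewrite mulr_ge0// powR_ge0.
  - by rewrite !mulr_ge0// ?addr_ge0// ltW.
  move=> n; have [i1 i2] := E_block_error (mn n).
  rewrite /V E_Z//.
  apply: (le_trans (ler_wpM2l (powR_ge0 _ _) i2)).
  rewrite mulrCA ler_wpM2l//; first by rewrite !mulr_ge0// ?addr_ge0// ltW.
  rewrite -pow2_Nnat /r -[(2 `^ _) ^+ n]powR_mulrn ?powR_ge0// !pow2M -pow2D ler_pow2.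
  rewrite natrB//; have := hm n; nra.
apply: filterS hV => w [D hD]; exists D => n.
rewrite powRN ler_pdivlMr ?pow2_gt0// mulrC; exact: hD.
Qed.

End BlockError.

(** * The Gaussian space of fractional Brownian motion *)

Section FractionalBrownianMotion.
Context {R : realType} {disp : measure_display} {Omega : measurableType disp}.
Variables (P : probability Omega R) (K : nat) (T H : R) (B : Omega -> R -> 'rV[R]_K).
Hypothesis fB : is_fBm P T H B.

(** The first Wiener chaos of B over [0, T], before taking the closure in L^2. *)
Definition fBm_span (Z : Omega -> R) : Prop :=
  exists (n : nat) (t : 'I_n -> R) (k : 'I_n -> 'I_K) (a : 'I_n -> R),
    (forall i, 0 <= t i <= T) /\ Z = fun w => \sum_i a i * B w (t i) 0 (k i).

Lemma fBm_span_coord (t : R) (k : 'I_K) : 0 <= t <= T -> fBm_span (fun w => B w t 0 k).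
Proof.
move=> ht; exists 1%N, (fun=> t), (fun=> k), (fun=> 1); split => //.
by apply/funext => w; rewrite big_ord1 mul1r.
Qed.

Lemma fBm_span_scale (c : R) Z : fBm_span Z -> fBm_span (fun w => c * Z w).
Proof.
move=> [n [t [k [a [ht ->]]]]]; exists n, t, k, (fun i => c * a i); split => //.
by apply/funext => w; rewrite mulr_sumr; apply: eq_bigr => i _; rewrite mulrA.
Qed.

Lemma fBm_span_add Y Z : fBm_span Y -> fBm_span Z -> fBm_span (fun w => Y w + Z w).
Proof.
move=> [n [t [k [a [ht ->]]]]] [n' [t' [k' [a' [ht' ->]]]]].
pose glue A (f : 'I_n -> A) (g : 'I_n' -> A) (i : 'I_(n + n')) : A :=
  match fintype.split i with inl j => f j | inr j => g j end.
have gl A f g j : @glue A f g (lshift n' j) = f j.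
  by rewrite /glue -/(unsplit (inl j)) unsplitK.
have gr A f g j : @glue A f g (rshift n j) = g j.
  by rewrite /glue -/(unsplit (inr j)) unsplitK.
exists (n + n')%N, (glue _ t t'), (glue _ k k'), (glue _ a a'); split.
  by move=> i; rewrite /glue; case: (fintype.split i).
apply/funext => w; rewrite big_split_ord /=.
by congr (_ + _); apply: eq_bigr => i _; rewrite ?gl ?gr.
Qed.

Lemma gaussian_L1 X : is_gaussian P X -> \int[P]_w X w = 0 -> L1 P X.
Proof.
move=> gX EX; have [i4 _] := gaussian_moment4 gX EX.
apply: (L1_le _ _ (L1D (L1_cst P 1) i4)); first by case: gX.
move=> w; set x := X w.
have -> : x ^+ 4 = `|x| ^+ 4 by rewrite -normrX ger0_norm// exprn_even_ge0.
set z := `|x|; have := sqr_ge0 (z - 2^-1); have := sqr_ge0 (z ^+ 2 - 2^-1); nra.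
Qed.

Lemma fBm_gaussian_space : gaussian_space P fBm_span.
Proof.
case: fB => gB mB cB _.
have gZ Z : fBm_span Z -> is_gaussian P Z.
  by move=> [n [t [k [a [ht ->]]]]]; exact: gB.
have EB (t : R) (k : 'I_K) : 0 <= t <= T -> \int[P]_w B w t 0 k = 0.
  by move=> ht; rewrite /Rintegral; have := mB t k ht; rewrite unlock => ->.
split => //; [|exact: fBm_span_add|exact: fBm_span_scale].
move=> Z [n [t [k [a [ht ->]]]]].
have iB i : L1 P (fun w => B w (t i) 0 (k i)).
  by apply: gaussian_L1; [exact/gZ/fBm_span_coord|exact: EB].
rewrite E_sum; last by move=> i; exact: L1Z.
by rewrite big1// => i _; rewrite E_Z// EB// mulr0.
Qed.

Lemma cov_fBm (s t : R) (k l : 'I_K) : 0 <= s <= T -> 0 <= t <= T ->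
  cov P (fun w => B w s 0 k) (fun w => B w t 0 l) =
  (2^-1 * (t `^ (2 * H) + s `^ (2 * H) - `|t - s| `^ (2 * H))) * (k == l)%:R.
Proof.
case: fB => _ _ cB _ hs ht; rewrite covC /cov /Rintegral eq_sym.
by have := cB s t l k hs ht; rewrite unlock => ->.
Qed.

Lemma cov_fBm_comb (e s t : R) (k l : 'I_K) : 0 <= s <= T -> 0 <= t <= T ->
  cov P (fun w => B w s 0 k + e * B w s 0 l) (fun w => B w t 0 k + e * B w t 0 l) =
  (1 + 2 * e * (k == l)%:R + e ^+ 2) *
  (2^-1 * (t `^ (2 * H) + s `^ (2 * H) - `|t - s| `^ (2 * H))).
Proof.
move=> hs ht; have hG := fBm_gaussian_space.
have Gs j := fBm_span_coord j hs; have Gt j := fBm_span_coord j ht.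
have Gs' := fBm_span_scale e (Gs l); have Gt' := fBm_span_scale e (Gt l).
have G3 := fBm_span_add (Gt k) Gt'.
rewrite (covDl hG)// (covZl hG)// !(covDr hG)// !(covZr hG)// !cov_fBm// !eqxx (eq_sym l) /=.
ring.
Qed.

(** The coordinates of B being uncorrelated, B^k + e B^l has the covariance of a
    multiple of a scalar fractional Brownian motion. *)
Lemma ae_fBm_block_error (m : nat -> nat) (q e : R) (k l : 'I_K) :
  0 < T -> 0 < H < 1 ->
  (forall n, (m n)%:R <= (1 - Num.max H 2^-1) * n%:R) ->
  q < Num.max H 2^-1 * (1 - Num.max H 2^-1) ->
  {ae P, forall w, exists C : R, forall n,
     block_error T H (1 + 2 * e * (k == l)%:R + e ^+ 2)
       (fun t => B w t 0 k + e * B w t 0 l) n (m n) <= C * 2 `^ (- (q * n%:R))}.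
Proof.
move=> T0 H01 hm hq.
apply: (@ae_block_error _ _ _ P _ fBm_gaussian_space T H _
  (fun t w => B w t 0 k + e * B w t 0 l) T0 H01) => //.
- case: (k == l) => /=; first by have := sqr_ge0 (1 + e); nra.
  by have := sqr_ge0 e; nra.
- move=> t ht; apply: fBm_span_add; first exact: fBm_span_coord.
  exact/fBm_span_scale/fBm_span_coord.
- by move=> s t hs ht; exact: cov_fBm_comb.
Qed.

End FractionalBrownianMotion.

(** * Local Lipschitz and Taylor estimates *)

Section MultivariateCalculus.
Context {R : realType} {d : nat}.
Implicit Types (f : 'rV[R]_d -> R) (x y z v : 'rV[R]_d) (r : R).

Lemma is_derive_along_line f v z (s : R) : derivable f (s *: v + z) v ->
  is_derive s (1 : R) (fun s : R => f (s *: v + z)) ('D_v f (s *: v + z)).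
Proof.
move=> df.
have E : (fun h : R => h^-1 *: (((fun s : R => f (s *: v + z)) \o shift s) (h *: (1 : R))
       - f (s *: v + z))) =
   (fun h : R => h^-1 *: ((f \o shift (s *: v + z)) (h *: v) - f (s *: v + z))).
  by apply/funext => h /=; rewrite [h *: 1]mulr1 addrA -scalerDl.
apply: DeriveDef.
  by rewrite /derivable E.
by rewrite /derive E.
Qed.

Lemma mean_value_along_line f v z (c : R) : (forall x, derivable f x v) ->
  exists2 s : R, 0 <= s <= 1 & f (c *: v + z) - f z = c * 'D_v f ((s * c) *: v + z).
Proof.
move=> df.
pose g (s : R) := f (s *: v + z).
have dg (s : R) : is_derive s (1 : R) g ('D_v f (s *: v + z)).
  exact: is_derive_along_line.
have cg : continuous g.
  move=> s; apply: differentiable_continuous; apply/derivable1_diffP.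
  by case: (dg s).
have g0 : f z = g 0 by rewrite /g scale0r add0r.
rewrite g0 -/(g c).
have [c0|c0|->] := ltgtP c 0; last first.
- by exists 0; rewrite ?lexx ?ler01// subrr mul0r.
- have [s] := MVT c0 (fun t _ => dg t) (continuous_subspaceT cg).
  rewrite in_itv /= => /andP[s1 s2]; rewrite subr0 => ->.
  exists (s / c); last by rewrite divfK ?gt_eqF// mulrC.
  apply/andP; split; first by apply: divr_ge0; exact: ltW.
  by rewrite ler_pdivrMr// mul1r; exact: ltW.
- have [s] := MVT c0 (fun t _ => dg t) (continuous_subspaceT cg).
  rewrite in_itv /= => /andP[s1 s2]; rewrite sub0r => E.
  exists (s / c); last by rewrite divfK ?lt_eqF// -opprB E; ring.
  rewrite -mulrNN -invrN; apply/andP; split.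
    by apply: divr_ge0; rewrite oppr_ge0; exact: ltW.
  by rewrite ler_pdivrMr ?oppr_gt0// mul1r lerN2; exact: ltW.
Qed.

(** Joining x to y by an axis-parallel polygonal path. *)
Lemma mean_value_coord f x y : (forall i x, derivable f x (delta_mx 0 i)) ->
  exists zeta : 'I_d -> 'rV[R]_d,
    (forall j i, exists2 s : R, 0 <= s <= 1 &
       zeta j 0 i = x 0 i + s * (y 0 i - x 0 i)) /\
    f y - f x = \sum_j (y 0 j - x 0 j) * partial j f (zeta j).
Proof.
move=> df.
pose z (j : nat) : 'rV[R]_d := \row_i (if (i < j)%N then y 0 i else x 0 i).
have z0 : z 0%N = x by apply/rowP => i; rewrite mxE ltn0.
have zd : z d = y by apply/rowP => i; rewrite mxE ltn_ord.
have zS (j : 'I_d) : z j.+1 = (y 0 j - x 0 j) *: delta_mx 0 j + z j.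
  apply/rowP => i; rewrite !mxE eqxx /=; have [->|ij] := eqVneq i j.
    by rewrite ltnSn ltnn mulr1 subrK.
  by rewrite mulr0 add0r ltnS ltn_neqAle (_ : (i : nat) != j).
have H (j : 'I_d) := mean_value_along_line (z j) (y 0 j - x 0 j) (df j).
have [s hs] := choice (fun j => let: ex_intro2 s a b := H j in ex_intro _ s (conj a b)).
exists (fun j => (s j * (y 0 j - x 0 j)) *: delta_mx 0 j + z j); split.
  move=> j i; have [s01 _] := hs j; rewrite !mxE eqxx /=.
  have [->|ij] := eqVneq i j.
    by exists (s j) => //; rewrite ltnn mulr1 addrC.
  rewrite mulr0 add0r; case: ifP => _.
    by exists 1; rewrite ?ler01 ?lexx// mul1r addrC subrK.
  by exists 0; rewrite ?ler01 ?lexx// mul0r addr0.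
have -> : f y - f x = \sum_(0 <= j < d) ((f \o z) j.+1 - (f \o z) j).
  by rewrite telescope_sumr//= z0 zd.
rewrite big_mkord.
by apply: eq_bigr => j _; have [_ <-] := hs j; rewrite /= zS.
Qed.

Lemma continuous_bounded_box f r : continuous f ->
  exists2 M : R, 0 <= M & forall x, (forall i, `|x 0 i| <= r) -> `|f x| <= M.
Proof.
move=> cf.
pose A : set 'rV[R]_d := [set x | forall i, `[- r, r]%classic (x ord0 i)].
have cA : compact A by apply: (@rV_compact R d (fun=> `[- r, r]%classic)) => i; exact: segment_compact.
have := compact_bounded (continuous_compact (continuous_subspaceT cf) cA).
move=> [M [_ HM]]; exists (`|M| + 1) => [|x hx]; first by rewrite addr_ge0.
apply: (HM (`|M| + 1)).
  by rewrite (le_lt_trans (ler_norm M))// ltrDl.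
by exists x => // i /=; rewrite in_itv /= -ler_norml.
Qed.

Let between r (a b s : R) : `|a| <= r -> `|b| <= r -> 0 <= s <= 1 ->
  `|a + s * (b - a)| <= r.
Proof.
rewrite !ler_norml => /andP[a1 a2] /andP[b1 b2] /andP[s0 s1]; apply/andP; split; nra.
Qed.

(** Boxes are compact and convex, so the partial derivatives are bounded on them
    and the intermediate points of the mean value formula stay inside. *)
Lemma C1_lipschitz_box f r : is_C 1 f ->
  exists2 L : R, 0 <= L & forall x y, (forall i, `|x 0 i| <= r) ->
    (forall i, `|y 0 i| <= r) -> `|f y - f x| <= L * \sum_i `|y 0 i - x 0 i|.
Proof.
move=> [cf df dC].
have [M hM] := choice (fun i : 'I_d =>
  let: ex_intro2 M a b := continuous_bounded_box r (dC i) in ex_intro _ M (conj a b)).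
exists (\sum_i M i); first by apply: sumr_ge0 => i _; case: (hM i).
move=> x y hx hy; have [zeta [hz ->]] := mean_value_coord x y df.
apply: (le_trans (ler_norm_sum _ _ _)).
rewrite mulr_sumr; apply: ler_sum => j _.
rewrite normrM mulrC ler_wpM2r//.
apply: (@le_trans _ _ (M j)).
  have [_] := hM j; apply => i; have [s s01 ->] := hz j i.
  exact: between.
by rewrite (bigD1 j)//= lerDl sumr_ge0// => i _; case: (hM i).
Qed.

(** In the mean value formula the derivatives are taken at intermediate points;
    replacing these by x costs a Lipschitz bound for the derivatives. *)
Lemma C2_taylor_box f r : is_C 2 f ->
  exists2 L : R, 0 <= L & forall x y, (forall i, `|x 0 i| <= r) ->
    (forall i, `|y 0 i| <= r) ->
    `|f y - f x - \sum_i (y 0 i - x 0 i) * partial i f x|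
      <= L * (\sum_i `|y 0 i - x 0 i|) ^+ 2.
Proof.
move=> [cf df dC].
have [L hL] := choice (fun i : 'I_d =>
  let: ex_intro2 L a b := C1_lipschitz_box r (dC i) in ex_intro _ L (conj a b)).
exists (\sum_i L i); first by apply: sumr_ge0 => i _; case: (hL i).
move=> x y hx hy; have [zeta [hz ->]] := mean_value_coord x y df.
rewrite -sumrB; apply: (le_trans (ler_norm_sum _ _ _)).
set S := \sum_i `|y 0 i - x 0 i|.
have S0 : 0 <= S by apply: sumr_ge0.
rewrite expr2 mulrA {2}/S mulr_sumr; apply: ler_sum => j _.
rewrite -mulrBr normrM mulrC ler_wpM2r//.
have [Lj0 Lj] := hL j.
apply: (@le_trans _ _ (L j * S)).
  apply: (le_trans (Lj x (zeta j) hx _)).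
    by move=> i; have [s s01 ->] := hz j i; exact: between.
  rewrite ler_wpM2l//; apply: ler_sum => i _; have [s /andP[s0 s1] ->] := hz j i.
  by rewrite addrC addKr normrM (ger0_norm s0) ler_piMl.
rewrite ler_wpM2r// (bigD1 j)//= lerDl sumr_ge0// => i _; by case: (hL i).
Qed.

End MultivariateCalculus.

(** * Hoelder paths *)

Section Paths.
Context {R : realType}.
Variable T : R.
Hypothesis T0 : 0 < T.
Implicit Types (a p q s t u : R) (phi psi : R -> R).

Lemma euclid_norm_ge0 m n (A : 'M[R]_(m, n)) : 0 <= euclid_norm A.
Proof. exact: sqrtr_ge0. Qed.

Lemma coord_le_euclid_norm m n (A : 'M[R]_(m, n)) i j : `|A i j| <= euclid_norm A.
Proof.
rewrite -sqrtr_sqr /euclid_norm ler_wsqrtr// (bigD1 i)//= (bigD1 j)//=.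
rewrite -addrA lerDl addr_ge0// ?sumr_ge0// => k _; rewrite ?sqr_ge0//.
by apply: sumr_ge0 => l _; exact: sqr_ge0.
Qed.

Lemma holder2_bound {V : Type} (N : V -> R) p (g : R -> R -> V) :
  (holder2 N T p g < +oo)%E ->
  exists2 C : R, 0 <= C & forall s t, 0 <= s -> s < t -> t <= T ->
    N (g s t) <= C * (t - s) `^ p.
Proof.
move=> hg; exists (Num.max 0 (fine (holder2 N T p g))).
  by rewrite le_max lexx.
move=> s t s0 st tT.
have ts : 0 < (t - s) `^ p by rewrite powR_gt0// subr_gt0.
rewrite -ler_pdivrMr// le_max; apply/orP; right.
have le : ((N (g s t) / (t - s) `^ p)%:E <= holder2 N T p g)%E.
  by apply: ereal_sup_ubound; exists (s, t).
rewrite -lee_fin fineK// fin_numElt hg andbT (lt_le_trans _ le)// ltNye_eq.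
by [].
Qed.

Lemma powR_le_lower_exponent p q u : 0 < u -> u <= T -> p <= q ->
  u `^ q <= T `^ (q - p) * u `^ p.
Proof.
move=> u0 uT pq.
have -> : u `^ q = u `^ (q - p) * u `^ p.
  by rewrite -powRD ?subrK// (lt0r_neq0 u0) implybT.
rewrite ler_wpM2r ?powR_ge0//; apply: ge0_ler_powR => //; rewrite ?nnegrE ?subr_ge0//.
  exact: ltW.
exact: ltW.
Qed.

(** The bound on phi itself makes the class stable under products. *)
Definition holder_path a phi : Prop :=
  exists2 C : R, 0 <= C & (forall t, 0 <= t <= T -> `|phi t| <= C) /\
    (forall s t, 0 <= s -> s < t -> t <= T -> `|phi t - phi s| <= C * (t - s) `^ a).

Lemma holder_path_cst a (c : R) : holder_path a (fun=> c).
Proof.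
exists `|c| => //; split => // s t _ _ _.
by rewrite subrr normr0 mulr_ge0// powR_ge0.
Qed.

Lemma holder_path_add a phi psi : holder_path a phi -> holder_path a psi ->
  holder_path a (fun t => phi t + psi t).
Proof.
move=> [C C0 [b h]] [C' C'0 [b' h']]; exists (C + C'); first exact: addr_ge0.
split=> [t ht|s t s0 st tT].
  by rewrite (le_trans (ler_normD _ _))// lerD// ?b ?b'.
rewrite opprD addrACA mulrDl (le_trans (ler_normD _ _))//.
by rewrite lerD// ?h ?h'.
Qed.

Lemma holder_path_mul a phi psi : holder_path a phi -> holder_path a psi ->
  holder_path a (fun t => phi t * psi t).
Proof.
move=> [C C0 [b h]] [C' C'0 [b' h']]; exists (2 * C * C').
  by rewrite !mulr_ge0.
have CC : 0 <= C * C' by exact: mulr_ge0.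
split=> [t ht|s t s0 st tT].
  rewrite normrM (@le_trans _ _ (C * C'))//; first by rewrite ler_pM// ?b ?b'.
  lra.
have hs : 0 <= s <= T by rewrite s0 (le_trans (ltW st)).
have ht : 0 <= t <= T by rewrite tT (le_trans s0 (ltW st)).
have -> : phi t * psi t - phi s * psi s =
  (phi t - phi s) * psi t + phi s * (psi t - psi s) by ring.
rewrite (le_trans (ler_normD _ _))// !normrM.
have e1 : `|phi t - phi s| * `|psi t| <= C * (t - s) `^ a * C'.
  by rewrite ler_pM// ?b' ?h.
have e2 : `|phi s| * `|psi t - psi s| <= C * (C' * (t - s) `^ a).
  by rewrite ler_pM// ?b ?h'.
have -> : 2 * C * C' * (t - s) `^ a = C * (t - s) `^ a * C' + C * (C' * (t - s) `^ a) by ring.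
exact: lerD.
Qed.

Lemma holder_path_sum a n (phi : 'I_n -> R -> R) : (forall i, holder_path a (phi i)) ->
  holder_path a (fun t => \sum_i phi i t).
Proof.
elim: n phi => [|n IH] phi h.
  rewrite (_ : (fun t => _) = (fun=> 0)); first exact: holder_path_cst.
  by apply/funext => t; rewrite big_ord0.
rewrite (_ : (fun t => _) = (fun t => phi ord0 t + \sum_(i < n) phi (lift ord0 i) t)).
  by apply: holder_path_add => //; apply: IH => i; exact: h.
by apply/funext => t; rewrite big_ord_recl.
Qed.

Lemma holder_path_coord n a (x : R -> 'rV[R]_n) j : 0 < a ->
  (holder euclid_norm T a x < +oo)%E -> holder_path a (fun t => x t 0 j).
Proof.
move=> a0 /holder2_bound[C C0 h].
have h' s t : 0 <= s -> s < t -> t <= T -> `|x t 0 j - x s 0 j| <= C * (t - s) `^ a.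
  move=> s0 st tT; apply: le_trans (h s t s0 st tT).
  by apply: le_trans (coord_le_euclid_norm _ 0 j); rewrite /incr !mxE.
exists (C + (`|x 0 0 j| + C * T `^ a)).
  by rewrite !addr_ge0// mulr_ge0// powR_ge0.
split=> [t /andP[t0 tT]|s t s0 st tT]; last first.
  apply: (le_trans (h' _ _ s0 st tT)); rewrite ler_wpM2r ?powR_ge0// lerDl.
  by rewrite addr_ge0// mulr_ge0// powR_ge0.
apply: (@le_trans _ _ (`|x 0 0 j| + C * T `^ a)); last by rewrite lerDr.
move: t0; rewrite le_eqVlt => /predU1P[<-|t0].
  by rewrite lerDl mulr_ge0// powR_ge0.
have -> : x t 0 j = x 0 0 j + (x t 0 j - x 0 0 j) by ring.
rewrite (le_trans (ler_normD _ _))// lerD2l (le_trans (h' _ _ _ t0 tT))//.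
rewrite ler_wpM2l// subr0; apply: ge0_ler_powR => //; rewrite ?nnegrE ?ltW//.
Qed.

Section Composition.
Context {d : nat}.
Variables (a : R) (y : R -> 'rV[R]_d).
Hypothesis hy : forall j, holder_path a (fun t => y t 0 j).

Lemma holder_path_common_bound :
  exists2 C : R, 0 <= C & (forall t j, 0 <= t <= T -> `|y t 0 j| <= C) /\
    (forall s t j, 0 <= s -> s < t -> t <= T ->
       `|y t 0 j - y s 0 j| <= C * (t - s) `^ a).
Proof.
have [C hC] := choice (fun j => let: ex_intro2 C a b := hy j in ex_intro _ C (conj a b)).
have CC j : C j <= \sum_i C i.
  by rewrite (bigD1 j)//= lerDl sumr_ge0// => i _; case: (hC i).
exists (\sum_i C i); first by apply: sumr_ge0 => i _; case: (hC i).
split=> [t j ht|s t j s0 st tT].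
  by have [_ [h _]] := hC j; exact: le_trans (h t ht) (CC j).
have [_ [_ h]] := hC j; apply: (le_trans (h _ _ s0 st tT)).
by rewrite ler_wpM2r ?powR_ge0.
Qed.

Lemma holder_path_comp_C1 (f : 'rV[R]_d -> R) : is_C 1 f ->
  holder_path a (fun t => f (y t)).
Proof.
move=> fC; have [r r0 [yb yh]] := holder_path_common_bound.
have [L L0 hL] := C1_lipschitz_box r fC.
have [M M0 hM] : exists2 M : R, 0 <= M & forall x : 'rV[R]_d, (forall i, `|x 0 i| <= r) -> `|f x| <= M.
  by apply: continuous_bounded_box; case: fC.
exists (M + L * (\sum_(i < d) r)).
  by rewrite addr_ge0// mulr_ge0// sumr_ge0.
split=> [t ht|s t s0 st tT].
  apply: (@le_trans _ _ M); first by apply: hM => i; exact: yb.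
  by rewrite lerDl mulr_ge0// sumr_ge0.
have hs : 0 <= s <= T by rewrite s0 (le_trans (ltW st)).
have ht : 0 <= t <= T by rewrite tT (le_trans s0 (ltW st)).
apply: (le_trans (hL (y s) (y t) _ _)) => [i|i|]; [exact: yb|exact: yb|].
rewrite mulrDl -[leLHS]add0r lerD//; first by rewrite mulr_ge0// powR_ge0.
rewrite -mulrA ler_wpM2l// mulr_suml; apply: ler_sum => i _.
exact: yh.
Qed.

End Composition.

End Paths.

Lemma is_C_weaken {R : realType} {d : nat} n (f : 'rV[R]_d -> R) : is_C n.+1 f -> is_C n f.
Proof. by elim: n f => [|n IH] f [cf df hf] //; split => // i; exact: IH. Qed.

Lemma is_C_le {R : realType} {d : nat} m n (f : 'rV[R]_d -> R) :
  (m <= n)%N -> is_C n f -> is_C m f.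
Proof.
move=> /subnK <-; elim: (n - m)%N => // k IH; rewrite addSn => /is_C_weaken; exact: IH.
Qed.

(** * The drift and the remainder of f(y) *)

Section DriftAndRemainder.
Context {R : realType}.
Variables (T a : R).
Hypothesis T0 : 0 < T.
Hypothesis a0 : 0 < a.
Context {d : nat}.
Variable y : R -> 'rV[R]_d.
Hypothesis hy : forall j, holder_path T a (fun t => y t 0 j).

Lemma holder_path_continuous : {within `[0, T], continuous y}.
Proof.
have [C C0 [yb yh]] := holder_path_common_bound hy.
apply/subspace_continuousP => x /=; rewrite in_itv /= => /andP[x0 xT].
apply/cvg_ballP => e e0.
have C1 : 0 < C + 1 by lra.
pose del := (e / (C + 1)) `^ a^-1.
have del0 : 0 < del by apply: powR_gt0; exact: divr_gt0.
rewrite near_withinE; near=> t; rewrite /= in_itv /= => /andP[t0 tT].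
split => // i j; rewrite (ord1 i) -ball_normE /=.
have xt : `|x - t| < del by near: t; apply: nbhsx_ballx.
have bnd s r : 0 <= s -> s < r -> r <= T -> r - s < del -> `|y r 0 j - y s 0 j| < e.
  move=> s0 sr rT rs; apply: (le_lt_trans (yh _ _ j s0 sr rT)).
  have lt : (r - s) `^ a < e / (C + 1).
    have -> : e / (C + 1) = del `^ a.
      by rewrite /del -powRrM mulVf ?gt_eqF// powRr1// divr_ge0// ltW.
    by rewrite gt0_ltr_powR// nnegrE ?subr_ge0 ltW.
  apply: (@le_lt_trans _ _ ((C + 1) * (r - s) `^ a)).
    by rewrite ler_wpM2r ?powR_ge0//; lra.
  by rewrite mulrC -ltr_pdivlMr.
have [xt'|xt'|->] := ltgtP x t; last by rewrite subrr normr0.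
- by rewrite distrC; apply: bnd => //; rewrite -(gtr0_norm (_ : 0 < t - x)) ?subr_gt0// distrC.
- by apply: bnd => //; rewrite -(gtr0_norm (_ : 0 < x - t)) ?subr_gt0.
Unshelve. all: by end_near. Qed.

Variable u : R -> 'rV[R]_d -> 'rV[R]_d.
Hypothesis cu : {within [set p : R * 'rV[R]_d | 0 <= p.1 <= T],
    continuous (fun p : R * 'rV[R]_d => u p.1 p.2)}.

Lemma continuous_along_path i : {within `[0, T], continuous (fun r => u r (y r) 0 i)}.
Proof.
apply/subspace_continuousP => x xT /=.
have cy := (subspace_continuousP _ _).1 holder_path_continuous x xT.
have xT' : 0 <= x <= T by move: xT => /=; rewrite in_itv.
have cux := (subspace_continuousP _ _).1 cu (x, y x) xT'.
have cpair : (fun r => (r, y r)) @ within `[0, T]%classic (nbhs x) -->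
   within [set p : R * 'rV[R]_d | 0 <= p.1 <= T] (nbhs (x, y x)).
  have c1 : (fun r => (r, y r)) @ within `[0, T]%classic (nbhs x) --> nbhs (x, y x).
    by apply: (@cvg_pair _ _ _ _ (nbhs x) (nbhs (y x))) => //; exact: cvg_within.
  move=> A wA; have := c1 _ wA.
  rewrite !near_simpl !near_withinE; apply: filterS => r h rT; apply: (h rT).
  by move: rT; rewrite /= in_itv.
have c2 := cvg_comp _ _ cpair cux.
apply: (@cvg_comp _ _ _ (fun r => u r (y r)) (fun M : 'rV[R]_d => M 0 i) _ _ _ c2).
exact: coord_continuous.
Qed.

(** The integrand r |-> u_r(y_r) is continuous, hence bounded on [0, T]. *)
Lemma drift_bound : exists2 C : R, 0 <= C &
  forall s t i, 0 <= s -> s < t -> t <= T -> `|drift u y s t 0 i| <= C * (t - s).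
Proof.
have hM (i : 'I_d) : exists M : R, 0 <= M /\ forall r, 0 <= r <= T -> `|u r (y r) 0 i| <= M.
  have := compact_bounded (continuous_compact (@continuous_along_path i) (@segment_compact _ 0 T)).
  move=> [M [_ HM]]; exists (`|M| + 1); split; first by rewrite addr_ge0.
  move=> r rT; apply: (HM (`|M| + 1)).
    by rewrite (le_lt_trans (ler_norm M))// ltrDl.
  by exists r => //=; rewrite in_itv.
have [M hM'] := choice hM.
exists (\sum_i M i); first by apply: sumr_ge0 => i _; case: (hM' i).
move=> s t i s0 st tT; rewrite mxE.
have [Mi0 Mi] := hM' i.
have sub : `[s, t]%classic `<=` `[0, T]%classic.
  by move=> r /=; rewrite !in_itv /= => /andP[sr rt]; rewrite (le_trans s0)// (le_trans rt).
have ig : lebesgue_measure.-integrable `[s, t] (EFin \o (fun r => u r (y r) 0 i)).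
  apply: continuous_compact_integrable; first exact: segment_compact.
  exact: continuous_subspaceW sub (@continuous_along_path i).
apply: (@le_trans _ _ (\int[lebesgue_measure]_(r in `[s, t]) M i)).
  apply: (le_trans (le_normr_Rintegral _ ig)) => //.
  apply: le_Rintegral => //.
  - exact: (integrable_norm ig).
  - apply: continuous_compact_integrable; first exact: segment_compact.
    by apply: continuous_subspaceT => x; exact: cvg_cst.
  - by move=> r /sub /=; rewrite in_itv /= => /Mi.
rewrite Rintegral_cst//= lebesgue_measure_itv /= lte_fin st -EFinB /=.
rewrite ler_wpM2r//; first by rewrite subr_ge0 ltW.
by rewrite (bigD1 i)//= lerDl sumr_ge0// => j _; case: (hM' j).
Qed.

Variables (K : nat) (tsigma : 'I_K -> 'rV[R]_d -> 'rV[R]_d) (b : R -> 'rV[R]_K).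
Hypothesis hR : (holder2 euclid_norm T (2 * a) (remainder1 u tsigma b y) < +oo)%E.

(** A Taylor expansion of f turns the expansion of y into that of f(y); the
    drift contributes a term of order t - s, hence the exponent. *)
Lemma sharp_bound (f : 'rV[R]_d -> R) : is_C 2 f -> exists2 C : R, 0 <= C &
  forall s t, 0 <= s -> s < t -> t <= T ->
    `|sharp tsigma f b y s t| <= C * (t - s) `^ (Num.min (2 * a) 1).
Proof.
move=> fC.
have [r r0 [yb yh]] := holder_path_common_bound hy.
have [L L0 hL] := C2_taylor_box r fC.
have [D D0 hD] := drift_bound.
have [C C0 hC] := holder2_bound hR.
have hM (i : 'I_d) : exists M : R, 0 <= M /\ forall t, 0 <= t <= T -> `|partial i f (y t)| <= M.
  have [_ _ dC] := fC.
  by have [M M0 [hM _]] := holder_path_comp_C1 hy (dC i); exists M.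
have [M hM'] := choice hM.
set rho := Num.min _ _.
have r1 : rho <= 2 * a by rewrite /rho ge_min lexx.
have r2 : rho <= 1 by rewrite /rho ge_min lexx orbT.
pose A := L * (d%:R * r) ^+ 2 + \sum_i C * M i.
pose A' := \sum_i D * M i.
have A0 : 0 <= A.
  rewrite addr_ge0// ?mulr_ge0// ?sqr_ge0// sumr_ge0// => i _.
  by rewrite mulr_ge0//; case: (hM' i).
have A'0 : 0 <= A' by rewrite sumr_ge0// => i _; rewrite mulr_ge0//; case: (hM' i).
exists (A * T `^ (2 * a - rho) + A' * T `^ (1 - rho)).
  by rewrite addr_ge0// mulr_ge0// powR_ge0.
move=> s t s0 st tT.
have hs : 0 <= s <= T by rewrite s0 (le_trans (ltW st)).
have ht : 0 <= t <= T by rewrite tT (le_trans s0 (ltW st)).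
have ts : 0 < t - s by rewrite subr_gt0.
have tsT : t - s <= T by rewrite lerBlDr (le_trans tT)// lerDl.
set v := t - s in ts tsT *.
have incrE i : y t 0 i - y s 0 i = remainder1 u tsigma b y s t 0 i + drift u y s t 0 i +
   \sum_k incr b s t 0 k * tsigma k (y s) 0 i.
  rewrite /remainder1 !mxE summxE.
  have -> : \sum_k (incr b s t 0 k *: tsigma k (y s)) 0 i =
     \sum_k incr b s t 0 k * tsigma k (y s) 0 i by apply: eq_bigr => k _; rewrite mxE.
  ring.
have sharpE : sharp tsigma f b y s t =
   (f (y t) - f (y s) - \sum_i (y t 0 i - y s 0 i) * partial i f (y s)) +
   (\sum_i remainder1 u tsigma b y s t 0 i * partial i f (y s) +
    \sum_i drift u y s t 0 i * partial i f (y s)).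
  have -> : \sum_i (y t 0 i - y s 0 i) * partial i f (y s) =
    (\sum_i remainder1 u tsigma b y s t 0 i * partial i f (y s) +
    \sum_i drift u y s t 0 i * partial i f (y s)) +
    \sum_k lie (tsigma k) f (y s) * incr b s t 0 k.
    have -> : \sum_k lie (tsigma k) f (y s) * incr b s t 0 k =
      \sum_i (\sum_k incr b s t 0 k * tsigma k (y s) 0 i) * partial i f (y s).
      under eq_bigr do rewrite /lie mulr_suml.
      rewrite exchange_big; apply: eq_bigr => i _; rewrite mulr_suml.
      by apply: eq_bigr => k _; ring.
    rewrite -!big_split /=; apply: eq_bigr => i _; rewrite incrE; ring.
  rewrite /sharp /incr /=; ring.
rewrite sharpE.
have e1 : `|f (y t) - f (y s) - \sum_i (y t 0 i - y s 0 i) * partial i f (y s)| <=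
   L * (d%:R * r) ^+ 2 * v `^ (2 * a).
  apply: (le_trans (hL (y s) (y t) _ _)) => [i|i|]; [exact: yb|exact: yb|].
  have -> : v `^ (2 * a) = (v `^ a) ^+ 2 by rewrite mulrC powRrM -powR_mulrn ?powR_ge0.
  rewrite -mulrA -exprMn ler_wpM2l//.
  have S0 : 0 <= \sum_i `|y t 0 i - y s 0 i| by apply: sumr_ge0.
  rewrite lerXn2r ?nnegrE// ?mulr_ge0 ?powR_ge0//.
  rewrite -mulrA mulr_natl -[X in _ *+ X](card_ord d) -sumr_const.
  by apply: ler_sum => i _; exact: yh.
have e2 : `|\sum_i remainder1 u tsigma b y s t 0 i * partial i f (y s)| <=
   (\sum_i C * M i) * v `^ (2 * a).
  apply: (le_trans (ler_norm_sum _ _ _)); rewrite mulr_suml; apply: ler_sum => i _.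
  have [M0 hMi] := hM' i; rewrite normrM mulrAC ler_pM//; last exact: hMi.
  exact: le_trans (coord_le_euclid_norm _ 0 i) (hC _ _ s0 st tT).
have e3 : `|\sum_i drift u y s t 0 i * partial i f (y s)| <= A' * v `^ 1.
  rewrite powRr1 ?(ltW ts)//.
  apply: (le_trans (ler_norm_sum _ _ _)); rewrite mulr_suml; apply: ler_sum => i _.
  have [M0 hMi] := hM' i; rewrite normrM mulrAC ler_pM//; last exact: hMi.
  exact: hD.
have p1 : v `^ (2 * a) <= T `^ (2 * a - rho) * v `^ rho by exact: powR_le_lower_exponent.
have p2 : v `^ 1 <= T `^ (1 - rho) * v `^ rho by exact: powR_le_lower_exponent.
apply: (le_trans (ler_normD _ _)).
apply: (@le_trans _ _ (A * v `^ (2 * a) + A' * v `^ 1)).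
  rewrite /A mulrDl -[leRHS]addrA lerD// (le_trans (ler_normD _ _))// lerD//.
by rewrite [leRHS]mulrDl; apply: lerD; rewrite -[leRHS]mulrA; apply: ler_wpM2l.
Qed.

End DriftAndRemainder.

(** * Dyadic sums and rates *)

Section Rates.
Context {R : realType}.
Implicit Types (q p : R) (v w : nat -> R).

(** Exponential rates 2^(- q n) of real sequences, with an unspecified constant. *)
Definition rate_le q v : Prop :=
  exists2 C : R, 0 <= C & forall n, `|v n| <= C * 2 `^ (- (q * n%:R)).

Lemma rate_le_add q v w : rate_le q v -> rate_le q w -> rate_le q (fun n => v n + w n).
Proof.
move=> [C C0 h] [C' C'0 h']; exists (C + C'); first exact: addr_ge0.
by move=> n; rewrite mulrDl (le_trans (ler_normD _ _))// lerD.
Qed.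

Lemma rate_le_scale q c v : rate_le q v -> rate_le q (fun n => c * v n).
Proof.
move=> [C C0 h]; exists (`|c| * C); first exact: mulr_ge0.
by move=> n; rewrite normrM -mulrA ler_wpM2l.
Qed.

Lemma rate_le_sum N q (v : 'I_N -> nat -> R) : (forall i, rate_le q (v i)) ->
  rate_le q (fun n => \sum_i v i n).
Proof.
elim: N v => [|N IH] v h.
  by exists 0 => // n; rewrite big_ord0 normr0 mul0r.
rewrite (_ : (fun n => _) = fun n => v ord0 n + \sum_(i < N) v (lift ord0 i) n).
  by apply: rate_le_add => //; apply: IH.
by apply/funext => n; rewrite big_ord_recl.
Qed.

Lemma rate_le_dom q v w : (forall n, `|v n| <= w n) -> rate_le q w -> rate_le q v.
Proof.
move=> vw [C C0 h]; exists C => // n; apply: le_trans (h n).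
exact: le_trans (vw n) (ler_norm _).
Qed.

Lemma rate_le_pow2 q p : q <= p -> rate_le q (fun n => 2 `^ (- (p * n%:R))).
Proof.
move=> qp; exists 1 => // n; rewrite mul1r ger0_norm ?powR_ge0// ler_pow2 lerN2.
by rewrite ler_wpM2r.
Qed.

Lemma mesh_powR (T p : R) n : 0 <= T -> (T / 2 ^+ n) `^ p = T `^ p * 2 `^ (- (p * n%:R)).
Proof.
by move=> T0; rewrite powRM ?invr_ge0 ?exprn_ge0// -pow2_Nnat pow2M mulNr [n%:R * p]mulrC.
Qed.

Lemma rate_le_mesh q p (T : R) : 0 <= T -> q <= p ->
  rate_le q (fun n => (T / 2 ^+ n) `^ p).
Proof.
move=> T0 qp; rewrite (_ : (fun n => _) = fun n => T `^ p * 2 `^ (- (p * n%:R))).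
  by apply: rate_le_scale; exact: rate_le_pow2.
by apply/funext => n; rewrite mesh_powR.
Qed.

End Rates.

Section DyadicSums.
Context {R : realType}.
Implicit Types (T : R).

Lemma dyadicS_sub T n i : dyadic T n i.+1 - dyadic T n i = T / 2 ^+ n.
Proof. by rewrite /dyadic -(@natr1 R i); ring. Qed.

Lemma dyadic_ge0 T n i : 0 < T -> 0 <= dyadic T n i.
Proof. by move=> T0; rewrite divr_ge0 ?mulr_ge0 ?exprn_ge0// ltW. Qed.

Lemma dyadic_ltS T n i : 0 < T -> dyadic T n i < dyadic T n i.+1.
Proof. by move=> T0; rewrite -subr_gt0 dyadicS_sub divr_gt0// exprn_gt0. Qed.

Lemma dyadic_le T n i : 0 < T -> (i <= 2 ^ n)%N -> dyadic T n i <= T.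
Proof.
move=> T0 i2; rewrite /dyadic ler_pdivrMr ?exprn_gt0// mulrC ler_pM2l//.
by rewrite -natrX ler_nat.
Qed.

Lemma sum_blocks n m (F : nat -> R) : (m <= n)%N ->
  \sum_(i < 2 ^ n) F i = \sum_(j < 2 ^ m) \sum_(i < 2 ^ (n - m)) F (j * 2 ^ (n - m) + i)%N.
Proof.
move=> mn; rewrite -[n in LHS](subnKC mn) expnD; set N := (2 ^ (n - m))%N.
elim: (2 ^ m)%N => [|q IH]; first by rewrite mul0n !big_ord0.
rewrite big_ord_recr /= -IH mulSn addnC -(big_mkord xpredT F) (@big_cat_nat _ _ _ (q * N))//=; last first.
  by rewrite leq_addr.
rewrite big_mkord; congr (_ + _).
by rewrite -{1}[(q * N)%N]add0n big_addn addnC addnK big_mkord; apply: eq_bigr => i _; rewrite addnC.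
Qed.

(** On blocks of mesh T / 2 ^ m the weight g is nearly constant, so that only
    the block sums of xi and the total variation of xi matter. *)
Lemma two_scale_bound T a (g : R -> R) (xi : nat -> R) (M : R) n m : 0 < T -> 0 < a ->
  0 <= M -> (forall t, 0 <= t <= T -> `|g t| <= M) ->
  (forall s t, 0 <= s -> s < t -> t <= T -> `|g t - g s| <= M * (t - s) `^ a) ->
  (m <= n)%N ->
  `|\sum_(i < 2 ^ n) g (dyadic T n i) * xi i| <=
    M * \sum_(j < 2 ^ m) `|\sum_(i < 2 ^ (n - m)) xi (j * 2 ^ (n - m) + i)%N| +
    M * (T / 2 ^+ m) `^ a * \sum_(i < 2 ^ n) `|xi i|.
Proof.
move=> T0 a0 M0 gb gh mn.
rewrite (sum_blocks (fun i => g (dyadic T n i) * xi i) mn).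
rewrite (sum_blocks (fun i => `|xi i|) mn).
set N := (2 ^ (n - m))%N.
have N0 : (0 < N)%N by rewrite expn_gt0.
have ND : N%:R * (T / 2 ^+ n) = T / 2 ^+ m.
  have -> : 2 ^+ n = 2 ^+ m * 2 ^+ (n - m) :> R by rewrite -exprD subnKC.
  by rewrite /N natrX; field; rewrite !expf_neq0.
rewrite !mulr_sumr -big_split; apply: (le_trans (ler_norm_sum _ _ _)).
apply: ler_sum => j _ /=.
have jN : (j * N + N <= 2 ^ n)%N.
  by rewrite addnC -mulSn -(subnKC mn) expnD leq_mul2r ltn_ord orbT.
rewrite (_ : \sum_(i < N) _ = g (dyadic T n (j * N)) * (\sum_(i < N) xi (j * N + i)%N) +
   \sum_(i < N) (g (dyadic T n (j * N + i)) - g (dyadic T n (j * N))) * xi (j * N + i)%N); last first.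
  by rewrite mulr_sumr -big_split; apply: eq_bigr => i _ /=; ring.
apply: (le_trans (ler_normD _ _)); rewrite normrM; apply: lerD.
  rewrite ler_wpM2r//; apply: gb; rewrite dyadic_ge0//= dyadic_le//.
  exact: leq_trans (leq_addr _ _) jN.
apply: (le_trans (ler_norm_sum _ _ _)); rewrite mulr_sumr.
apply: ler_sum => i _; rewrite normrM ler_wpM2r//.
have [->|i0] := posnP i.
  by rewrite addn0 subrr normr0 mulr_ge0// powR_ge0.
have tiE : dyadic T n (j * N + i) - dyadic T n (j * N) = i%:R * (T / 2 ^+ n).
  by rewrite /dyadic natrD; ring.
have ti0 : 0 < i%:R * (T / 2 ^+ n) by rewrite mulr_gt0 ?ltr0n// divr_gt0// exprn_gt0.
apply: (le_trans (gh _ _ _ _ _)).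
- exact: dyadic_ge0.
- by rewrite -subr_gt0 tiE.
- apply: dyadic_le => //; apply: leq_trans jN.
  by rewrite leq_add2l ltnW.
rewrite tiE ler_wpM2l//; apply: ge0_ler_powR; rewrite ?nnegrE ?(ltW a0) ?(ltW ti0)//.
  by rewrite ltW// divr_gt0// exprn_gt0.
rewrite -ND ler_wpM2r ?ler_nat; first by [].
  by rewrite ltW// divr_gt0// exprn_gt0.
exact: ltnW.
Qed.

End DyadicSums.

(** * The rate of the scaled variation of f(y) *)

Section VariationEstimate.
Context {R : realType} {K : nat}.
Variables (T H a rho q c : R) (m : nat -> nat).
Variables (b g : 'I_K -> R -> R) (x : R -> R).
Hypothesis T0 : 0 < T.
Hypothesis a0 : 0 < a.
Hypothesis aH : a <= H.
Hypothesis hb : forall k, holder_path T a (b k).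
Hypothesis hg : forall k, holder_path T a (g k).
Hypothesis hx : exists2 C : R, 0 <= C & forall s t, 0 <= s -> s < t -> t <= T ->
  `|x t - x s - \sum_k g k s * (b k t - b k s)| <= C * (t - s) `^ rho.
Hypothesis mn : forall n, (m n <= n)%N.
Hypothesis hm : forall n, 2 ^- (m n) <= 2 * 2 `^ (- (c * n%:R)) :> R.
Hypothesis hblock : forall (e : R) (k l : 'I_K), e \in [:: 1; -1] -> rate_le q (fun n =>
  block_error T H (1 + 2 * e * (k == l)%:R + e ^+ 2) (fun t => b k t + e * b l t) n (m n)).
Hypothesis q1 : q <= a + rho - 2 * H.
Hypothesis q2 : q <= 2 * rho - 2 * H.
Hypothesis q3 : q <= c * a - 2 * (H - a).

Let t_ n i : R := dyadic T n i.
Let D n : R := T / 2 ^+ n.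
Let db k n i : R := incr (b k) (t_ n i) (t_ n i.+1).

Let D0 n : 0 < D n. Proof. by rewrite divr_gt0// exprn_gt0. Qed.

Let t0 n i : 0 <= t_ n i. Proof. exact: dyadic_ge0. Qed.

Let tS n i : t_ n i < t_ n i.+1. Proof. exact: dyadic_ltS. Qed.

Let tT n (i : 'I_(2 ^ n)) : t_ n i.+1 <= T. Proof. exact: dyadic_le. Qed.

Let tT' n (i : 'I_(2 ^ n)) : 0 <= t_ n i <= T.
Proof. by rewrite t0 (le_trans (ltW (tS n i)) (tT i)). Qed.

Let powDD n : D n `^ (1 - 2 * H) * D n `^ (2 * H) = D n.
Proof. by rewrite -powRD subrK ?oner_eq0// powRr1// ltW. Qed.

Let powD_add n (r s : R) : D n `^ (r + s) = D n `^ r * D n `^ s.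
Proof. by rewrite powRD// (lt0r_neq0 (D0 n)) implybT. Qed.

Let sumD n : \sum_(i < 2 ^ n) D n = T.
Proof.
by rewrite sumr_const card_ord -mulr_natr natrX divfK.
Qed.

(** The centered products of increments, obtained by polarization from the
    centered squares of the increments of b k + b l and b k - b l. *)
Definition cross_error (k l : 'I_K) (n i : nat) : R :=
  D n `^ (1 - 2 * H) * (db k n i * db l n i) - (k == l)%:R * D n.

Let cross_errorE k l n i : cross_error k l n i =
  4^-1 * (scaled_error T H (1 + 2 * 1 * (k == l)%:R + 1 ^+ 2) (fun t => b k t + 1 * b l t) n i
   - scaled_error T H (1 + 2 * (-1) * (k == l)%:R + (-1) ^+ 2) (fun t => b k t + (-1) * b l t) n i).
Proof. by rewrite /cross_error /scaled_error /db /incr -/(D n) /t_; field. Qed.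

Let cross_block k l n :
  \sum_(j < 2 ^ m n) `|\sum_(i < 2 ^ (n - m n)) cross_error k l n (j * 2 ^ (n - m n) + i)%N| <=
  4^-1 * (block_error T H (1 + 2 * 1 * (k == l)%:R + 1 ^+ 2) (fun t => b k t + 1 * b l t) n (m n)
   + block_error T H (1 + 2 * (-1) * (k == l)%:R + (-1) ^+ 2) (fun t => b k t + (-1) * b l t) n (m n)).
Proof.
rewrite /block_error -big_split /= mulr_sumr; apply: ler_sum => j _.
under eq_bigr do rewrite cross_errorE.
rewrite -mulr_sumr sumrB normrM (ger0_norm (_ : 0 <= 4^-1))// ler_wpM2l//.
by rewrite (le_trans (ler_normB _ _)).
Qed.

Let db_bound : exists2 C : R, 0 <= C &
  forall k n (i : 'I_(2 ^ n)), `|db k n i| <= C * D n `^ a.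
Proof.
have [C hC] := choice (fun k => let: ex_intro2 C p r := hb k in ex_intro _ C (conj p r)).
exists (\sum_k C k); first by apply: sumr_ge0 => k _; case: (hC k).
move=> k n i; have [_ [_ h]] := hC k.
rewrite /db /incr; apply: (le_trans (h _ _ (t0 n i) (tS n i) (tT i))).
rewrite dyadicS_sub ler_wpM2r ?powR_ge0// (bigD1 k)//= lerDl.
by apply: sumr_ge0 => l _; case: (hC l).
Qed.

(** Only Hoelder continuity of order a <= H is used here, and this loses the
    factor 2^(2 (H - a) n) with respect to the true order of the sum. *)
Let cross_total k l : exists2 A : R, 0 <= A &
  forall n, \sum_(i < 2 ^ n) `|cross_error k l n i| <= A * 2 `^ (2 * (H - a) * n%:R).
Proof.
have [C C0 hC] := db_bound.
exists (T * C ^+ 2 * T `^ (2 * a - 2 * H) + T).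
  by rewrite addr_ge0 ?(ltW T0)// !mulr_ge0 ?sqr_ge0 ?powR_ge0// ltW.
move=> n.
have e1 : 1 <= 2 `^ (2 * (H - a) * n%:R) :> R.
  rewrite -[leLHS](powRr0 2) ler_pow2; do 2 apply: mulr_ge0 => //.
  by rewrite subr_ge0.
have e2 : D n `^ (2 * a - 2 * H) = T `^ (2 * a - 2 * H) * 2 `^ (2 * (H - a) * n%:R).
  by rewrite /D mesh_powR ?(ltW T0)//; congr (_ * 2 `^ _); ring.
apply: (@le_trans _ _ (\sum_(i < 2 ^ n) (C ^+ 2 * D n `^ (2 * a - 2 * H) * D n + D n))).
  apply: ler_sum => i _; rewrite /cross_error (le_trans (ler_normB _ _))//.
  apply: lerD; last first.
    by rewrite normrM (gtr0_norm (D0 n)); case: (k == l); rewrite ?normr1 ?normr0 ?mul1r ?mul0r// ltW.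
  rewrite normrM (ger0_norm (powR_ge0 _ _)) normrM.
  apply: (@le_trans _ _ (D n `^ (1 - 2 * H) * (C * D n `^ a * (C * D n `^ a)))).
    by rewrite ler_wpM2l ?powR_ge0// ler_pM.
  rewrite -{5}(powDD n) le_eqVlt; apply/orP; left; apply/eqP.
  have -> : 2 * a - 2 * H = a + (a + - (2 * H)) by ring.
  rewrite !powD_add powRN; field.
  by rewrite gt_eqF// powR_gt0.
rewrite big_split /= -mulr_sumr sumD e2 [leRHS]mulrDl; apply: lerD; last first.
  by rewrite ler_peMr// ltW.
by rewrite le_eqVlt; apply/orP; left; apply/eqP; ring.
Qed.

(** The blocks contribute at rate q by assumption; freezing the weights g k g l
    costs c a, from their Hoelder continuity, minus the loss in [cross_total]. *)
Lemma rate_cross k l : rate_le q (fun n =>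
  \sum_(i < 2 ^ n) g k (t_ n i) * g l (t_ n i) * cross_error k l n i).
Proof.
have [M M0 [gb gh]] := holder_path_mul (hg k) (hg l).
have [A A0 hA] := cross_total k l.
pose be e := fun n => block_error T H (1 + 2 * e * (k == l)%:R + e ^+ 2) (fun t => b k t + e * b l t) n (m n).
apply: (@rate_le_dom _ q _ (fun n => M * 4^-1 * (be 1 n + be (-1) n) +
   (M * (2 * T) `^ a * A) * 2 `^ (- ((c * a - 2 * (H - a)) * n%:R)))); last first.
  apply: rate_le_add; apply: rate_le_scale; last exact: rate_le_pow2.
  by apply: rate_le_add; apply: hblock; rewrite !inE eqxx ?orbT.
move=> n; have := two_scale_bound (cross_error k l n) T0 a0 M0 gb gh (mn n).
move=> H1; apply: (le_trans H1); apply: lerD.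
  by rewrite -mulrA ler_wpM2l// cross_block.
rewrite -!mulrA ler_wpM2l//.
have -> : - ((c * a - 2 * (H - a)) * n%:R) = - (c * n%:R) * a + 2 * (H - a) * n%:R by ring.
rewrite pow2D -(pow2M (- (c * n%:R)) a).
have -> : (2 * T) `^ a * (A * ((2 `^ (- (c * n%:R))) `^ a * 2 `^ (2 * (H - a) * n%:R))) =
  ((2 * T) `^ a * (2 `^ (- (c * n%:R))) `^ a) * (A * 2 `^ (2 * (H - a) * n%:R)) by ring.
apply: ler_pM; rewrite ?powR_ge0 ?sumr_ge0//.
rewrite -powRM ?powR_ge0//; last by rewrite mulr_ge0// ltW.
apply: ge0_ler_powR; rewrite ?nnegrE ?(ltW a0)//.
- by rewrite divr_ge0 ?exprn_ge0// ltW.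
- by rewrite !mulr_ge0 ?powR_ge0// ltW.
by rewrite mulrAC mulrC ler_wpM2r ?(ltW T0)// mulrC.
Qed.

(** The square of the increment of x is A^2 + 2 A r + r^2, with A linear in the
    increments of b and r the remainder: A^2 gives the Riemann sum and the cross
    errors, A r is of order a + rho, and r^2 of order 2 rho. *)
Lemma rate_variation : rate_le q (fun n =>
  scaled_variation_n T (1 - 2 * H) x n T -
  \sum_(i < 2 ^ n) (\sum_k g k (t_ n i) ^+ 2) * D n).
Proof.
have [C C0 hC] := hx.
have [Cb Cb0 hCb] := db_bound.
have [M hM] := choice (fun k => let: ex_intro2 C p r := hg k in ex_intro _ C (conj p r)).
pose A n i := \sum_k g k (t_ n i) * db k n i.
pose r n i := incr x (t_ n i) (t_ n i.+1) - A n i.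
pose CA := \sum_k M k * Cb.
have CA0 : 0 <= CA by apply: sumr_ge0 => k _; rewrite mulr_ge0//; case: (hM k).
have hA n (i : 'I_(2 ^ n)) : `|A n i| <= CA * D n `^ a.
  apply: (le_trans (ler_norm_sum _ _ _)); rewrite mulr_suml; apply: ler_sum => k _.
  have [M0 [h _]] := hM k; rewrite normrM -mulrA; apply: ler_pM => //.
  exact/h/tT'.
have hr n (i : 'I_(2 ^ n)) : `|r n i| <= C * D n `^ rho.
  by have := hC _ _ (t0 n i) (tS n i) (tT i); rewrite dyadicS_sub.
have E n : scaled_variation_n T (1 - 2 * H) x n T -
    \sum_(i < 2 ^ n) (\sum_k g k (t_ n i) ^+ 2) * D n =
  \sum_k \sum_l \sum_(i < 2 ^ n) g k (t_ n i) * g l (t_ n i) * cross_error k l n i +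
  \sum_(i < 2 ^ n) D n `^ (1 - 2 * H) * (2 * A n i * r n i + r n i ^+ 2).
  have -> : \sum_k \sum_l \sum_(i < 2 ^ n) g k (t_ n i) * g l (t_ n i) * cross_error k l n i =
     \sum_(i < 2 ^ n) (D n `^ (1 - 2 * H) * A n i ^+ 2 - (\sum_k g k (t_ n i) ^+ 2) * D n).
    under eq_bigr do rewrite exchange_big.
    rewrite exchange_big; apply: eq_bigr => i _ /=.
    rewrite expr2 {1}/A mulr_suml mulr_sumr mulr_suml -sumrB; apply: eq_bigr => k _.
    rewrite /A mulr_sumr mulr_sumr.
    rewrite (_ : g k (t_ n i) ^+ 2 * D n = \sum_l g k (t_ n i) * g l (t_ n i) * ((k == l)%:R * D n)).
      by rewrite -sumrB; apply: eq_bigr => l _; rewrite /cross_error; ring.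
    rewrite (bigD1 k)//= eqxx mul1r big1 ?addr0 ?expr2// => l lk.
    by rewrite eq_sym (negbTE lk) mul0r mulr0.
  rewrite /scaled_variation_n (eq_bigl xpredT); last by move=> i; rewrite tT.
  rewrite -sumrB -big_split /=; apply: eq_bigr => i _.
  by rewrite dyadicS_sub -/(D n) /r; ring.
rewrite (funext E).
apply: rate_le_add.
  by apply: rate_le_sum => k; apply: rate_le_sum => l; exact: rate_cross.
apply: (@rate_le_dom _ q _ (fun n => 2 * T * CA * C * D n `^ (a + rho - 2 * H) +
   T * C ^+ 2 * D n `^ (2 * rho - 2 * H))); last first.
  by apply: rate_le_add; apply: rate_le_scale; apply: rate_le_mesh => //; exact: ltW.
move=> n.
have -> : 2 * T * CA * C * D n `^ (a + rho - 2 * H) + T * C ^+ 2 * D n `^ (2 * rho - 2 * H) =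
  \sum_(i < 2 ^ n) D n `^ (1 - 2 * H) * (2 * (CA * D n `^ a) * (C * D n `^ rho) + (C * D n `^ rho) ^+ 2).
  pose w := 2 * CA * C * D n `^ (a + rho - 2 * H) + C ^+ 2 * D n `^ (2 * rho - 2 * H).
  transitivity (\sum_(i < 2 ^ n) w * D n); first by rewrite -mulr_sumr sumD /w; ring.
  apply: eq_bigr => i _; rewrite -[in LHS](powDD n) /w.
  have -> : a + rho - 2 * H = a + (rho + - (2 * H)) by ring.
  have -> : 2 * rho - 2 * H = rho + (rho + - (2 * H)) by ring.
  rewrite !powD_add [D n `^ (- _)]powRN; field.
  by rewrite gt_eqF// powR_gt0.
apply: (le_trans (ler_norm_sum _ _ _)); apply: ler_sum => i _.
rewrite normrM (ger0_norm (powR_ge0 _ _)) ler_wpM2l ?powR_ge0//.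
apply: (le_trans (ler_normD _ _)); apply: lerD.
  rewrite !normrM (ger0_norm (_ : 0 <= 2))// ler_pM ?mulr_ge0//.
  by rewrite ler_wpM2l.
by rewrite normrX lerXn2r ?nnegrE// mulr_ge0// powR_ge0.
Qed.

End VariationEstimate.

(** * Least squares *)

Section LeastSquares.
Context {R : realType}.

Definition norm1 {n : nat} (v : 'cV[R]_n) : R := \sum_i `|v i 0|.

Definition dot {n : nat} (v w : 'cV[R]_n) : R := \sum_i v i 0 * w i 0.

Lemma dot_mx n (v w : 'cV[R]_n) : v^T *m w = (dot v w)%:M.
Proof.
apply/matrixP => i j; rewrite !mxE (ord1 i) (ord1 j) eqxx mulr1n.
by apply: eq_bigr => k _; rewrite mxE.
Qed.

Lemma sqr_euclid_norm n (v : 'cV[R]_n) : euclid_norm v ^+ 2 = dot v v.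
Proof.
rewrite sqr_sqrtr; last by do 2 (apply: sumr_ge0 => ? _); exact: sqr_ge0.
by apply: eq_bigr => i _; rewrite big_ord1 expr2.
Qed.

Lemma dot_ge0 n (v : 'cV[R]_n) : 0 <= dot v v.
Proof. by rewrite -sqr_euclid_norm sqr_ge0. Qed.

Lemma euclid_norm_le_norm1 n (v : 'cV[R]_n) : euclid_norm v <= norm1 v.
Proof.
have n0 : 0 <= norm1 v by apply: sumr_ge0.
rewrite -(ger0_norm n0) -sqrtr_sqr ler_wsqrtr// expr2 {1}/norm1 mulr_suml.
apply: ler_sum => i _; rewrite big_ord1 -real_normK ?num_real// expr2.
by rewrite ler_wpM2l// /norm1 (bigD1 i)//= lerDl sumr_ge0.
Qed.

Lemma norm1_le_euclid_norm n (v : 'cV[R]_n) : norm1 v <= n%:R * euclid_norm v.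
Proof.
apply: (@le_trans _ _ (\sum_(i < n) euclid_norm v)).
  by apply: ler_sum => i _; exact: coord_le_euclid_norm.
by rewrite sumr_const card_ord -[_ *+ n]mulr_natl.
Qed.

Lemma norm1_eq0 n (v : 'cV[R]_n) : norm1 v <= 0 -> v = 0.
Proof.
move=> v0; apply/colP => i; rewrite mxE; apply/eqP; rewrite -normr_le0.
by apply: le_trans v0; rewrite /norm1 (bigD1 i)//= lerDl sumr_ge0.
Qed.

Lemma norm1_mulmx_le n p (A : 'M[R]_(n, p)) (v : 'cV[R]_p) (a : R) :
  (forall j, \sum_i `|A i j| <= a) -> norm1 (A *m v) <= a * norm1 v.
Proof.
move=> hA; apply: (@le_trans _ _ (\sum_i \sum_j `|A i j| * `|v j 0|)).
  apply: ler_sum => i _; rewrite mxE; apply: (le_trans (ler_norm_sum _ _ _)).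
  by apply: ler_sum => j _; rewrite normrM.
rewrite exchange_big mulr_sumr; apply: ler_sum => j _ /=.
by rewrite -mulr_suml ler_wpM2r.
Qed.

Lemma norm1_add n (v w : 'cV[R]_n) : norm1 (v + w) <= norm1 v + norm1 w.
Proof.
rewrite -big_split; apply: ler_sum => i _ /=.
by rewrite mxE ler_normD.
Qed.

Section Regression.
Variables (M K : nat) (X : 'M[R]_(M, K)) (Y : 'cV[R]_M) (L : R).
Hypothesis L0 : 0 <= L.
Hypothesis hX : forall v : 'cV[R]_K, norm1 v <= L * norm1 (X *m v).

Let injX (v : 'cV[R]_K) : dot (X *m v) (X *m v) = 0 -> v = 0.
Proof.
move=> h; apply: norm1_eq0; apply: (le_trans (hX v)).
have -> : X *m v = 0; last first.
  by rewrite /norm1 big1 ?mulr0// => i _; rewrite mxE normr0.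
apply: norm1_eq0; apply: (le_trans (norm1_le_euclid_norm _)).
have /eqP : euclid_norm (X *m v) ^+ 2 = 0 by rewrite sqr_euclid_norm.
by rewrite sqrf_eq0 => /eqP ->; rewrite mulr0.
Qed.

Let unitXX : X^T *m X \in unitmx.
Proof.
rewrite -row_free_unit; apply: inj_row_free => v vXX.
apply: trmx_inj; rewrite trmx0; apply: injX.
have : (X *m v^T)^T *m (X *m v^T) = 0.
  by rewrite trmx_mul trmxK -mulmxA (mulmxA X^T) mulmxA vXX mul0mx.
by rewrite dot_mx => /matrixP /(_ 0 0); rewrite !mxE mulr1n.
Qed.

(** X b is the orthogonal projection of Y on the range of X, so X (c - b) is the
    projection of X c - Y; by Pythagoras' theorem it is no longer than that. *)
Lemma least_squares : exists b : 'cV[R]_K, unique (is_argmin X Y) b /\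
  forall c : 'cV[R]_K, euclid_norm (c - b) <= L * M%:R * euclid_norm (Y - X *m c).
Proof.
pose b := invmx (X^T *m X) *m (X^T *m Y).
have normal : X^T *m (Y - X *m b) = 0.
  by rewrite mulmxBr /b mulmxA mulKVmx// subrr.
have pyth c : euclid_norm (Y - X *m c) ^+ 2 =
    euclid_norm (Y - X *m b) ^+ 2 + euclid_norm (X *m (c - b)) ^+ 2.
  rewrite !sqr_euclid_norm.
  have E : Y - X *m c = (Y - X *m b) - X *m (c - b).
    by rewrite mulmxBr opprB addrA addrNK.
  have orth : dot (X *m (c - b)) (Y - X *m b) = 0.
    have : (X *m (c - b))^T *m (Y - X *m b) = 0 by rewrite trmx_mul -mulmxA normal mulmx0.
    by rewrite dot_mx => /matrixP /(_ 0 0); rewrite !mxE mulr1n.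
  rewrite E; set e := Y - X *m b in orth *; set w := X *m (c - b) in orth *.
  have -> : dot (e - w) (e - w) = dot e e - 2 * dot w e + dot w w.
    rewrite /dot mulr_sumr -sumrB -big_split; apply: eq_bigr => i _ /=.
    by rewrite !mxE; ring.
  by rewrite orth mulr0 subr0.
have le_sqr (v w : 'cV[R]_M) : euclid_norm v ^+ 2 <= euclid_norm w ^+ 2 ->
    euclid_norm v <= euclid_norm w.
  by rewrite ler_pXn2r ?nnegrE ?euclid_norm_ge0.
have bmin : is_argmin X Y b.
  by move=> c; apply: le_sqr; rewrite [leRHS]pyth lerDl sqr_ge0.
exists b; split.
  split => // c cmin; apply/esym/eqP; rewrite -subr_eq0; apply/eqP; apply: injX.
  have := cmin b; rewrite -(@ler_pXn2r _ 2) ?nnegrE ?euclid_norm_ge0// pyth gerDl sqr_euclid_norm.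
  by move=> h; apply/eqP; rewrite eq_le h dot_ge0.
move=> c; apply: (le_trans (euclid_norm_le_norm1 _)).
apply: (le_trans (hX _)); rewrite -mulrA ler_wpM2l//.
apply: (le_trans (norm1_le_euclid_norm _)); rewrite ler_wpM2l//.
by apply: le_sqr; rewrite [leRHS]pyth lerDr sqr_ge0.
Qed.

End Regression.

(** With a left inverse A of X, one has v = A X' v + A (X - X') v, and the second
    term is at most half as large as v. *)
Lemma perturbed_injectivity M K (X X' : 'M[R]_(M, K)) (A : 'M[R]_(K, M)) (a : R) :
  A *m X = 1%:M -> 0 <= a -> (forall j, \sum_i `|A i j| <= a) ->
  (forall k, a * \sum_m `|(X - X') m k| <= 2^-1) ->
  forall v : 'cV[R]_K, norm1 v <= 2 * a * norm1 (X' *m v).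
Proof.
move=> AX a0 hA hX v.
have vE : v = A *m (X' *m v) + (A *m (X - X')) *m v.
  by rewrite mulmxBr AX mulmxBl mul1mx mulmxA addrC subrK.
have n0 : 0 <= norm1 v by apply: sumr_ge0.
have e1 : norm1 (A *m (X' *m v)) <= a * norm1 (X' *m v) by exact: norm1_mulmx_le.
have e2 : norm1 ((A *m (X - X')) *m v) <= 2^-1 * norm1 v.
  apply: norm1_mulmx_le => k; apply: le_trans (hX k).
  rewrite mulr_sumr.
  apply: (@le_trans _ _ (\sum_i \sum_m `|A i m| * `|(X - X') m k|)).
    apply: ler_sum => i _; rewrite mxE; apply: (le_trans (ler_norm_sum _ _ _)).
    by apply: ler_sum => m _; rewrite normrM.
  rewrite exchange_big; apply: ler_sum => m _ /=.
  by rewrite -mulr_suml ler_wpM2r.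
have := norm1_add (A *m (X' *m v)) ((A *m (X - X')) *m v); rewrite -vE.
lra.
Qed.

End LeastSquares.

(** * Riemann sums and the rate of the estimator *)

Section RiemannSums.
Context {R : realType}.

Lemma holder_path_continuous_real (T a : R) (phi : R -> R) : 0 < a ->
  holder_path T a phi -> {within `[0, T], continuous phi}.
Proof.
move=> a0 h.
pose y (t : R) : 'rV[R]_1 := \row_(j < 1) phi t.
have hy (j : 'I_1) : holder_path T a (fun t => y t 0 j).
  by rewrite (_ : (fun t => _) = phi)//; apply/funext => t; rewrite mxE.
have cy := holder_path_continuous a0 hy.
apply/subspace_continuousP => x xT /=.
have cyx := (subspace_continuousP _ _).1 cy x xT.
have := @cvg_comp _ _ _ y (fun M : 'rV[R]_1 => M 0 0) _ _ _ cyx (@coord_continuous _ _ _ 0 0 (y x)).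
rewrite /= mxE (_ : _ \o _ = phi)//.
by apply/funext => t; rewrite /= mxE.
Qed.

(** On each interval of length D the error is at most C D^a D. *)
Lemma riemann_rate (T a : R) (phi : R -> R) : 0 < T -> 0 < a -> holder_path T a phi ->
  rate_le a (fun n => \int[lebesgue_measure]_(r in `[0, T]) phi r -
    \sum_(i < 2 ^ n) phi (dyadic T n i) * (T / 2 ^+ n)).
Proof.
move=> T0 a0 h; have cphi := holder_path_continuous_real a0 h.
have [C C0 [hb hh]] := h.
have ig (s t : R) : 0 <= s -> t <= T -> lebesgue_measure.-integrable `[s, t] (EFin \o phi).
  move=> s0 tT; apply: continuous_compact_integrable; first exact: segment_compact.
  apply: continuous_subspaceW cphi => r /=; rewrite !in_itv /= => /andP[sr rt].
  by rewrite (le_trans s0 sr) (le_trans rt tT).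
have step (s t : R) : 0 <= s -> s < t -> t <= T ->
    `|\int[lebesgue_measure]_(r in `]s, t]) phi r - phi s * (t - s)| <= C * (t - s) `^ a * (t - s).
  move=> s0 st tT.
  have igo : lebesgue_measure.-integrable `]s, t] (EFin \o phi).
    apply: (integrableS _ _ _ (ig s t s0 tT)) => //.
    by move=> r /=; rewrite !in_itv /= => /andP[/ltW -> ->].
  have igc (c : R) : lebesgue_measure.-integrable `]s, t] (EFin \o (fun=> c)).
    have igc' : lebesgue_measure.-integrable `[s, t] (EFin \o (fun=> c)).
      apply: continuous_compact_integrable; first exact: segment_compact.
      by apply: continuous_subspaceT => x; exact: cvg_cst.
    apply: (integrableS _ _ _ igc') => //.
    by move=> r /=; rewrite !in_itv /= => /andP[/ltW -> ->].
  have cE (c : R) : \int[lebesgue_measure]_(r in `]s, t]) c = c * (t - s).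
    by rewrite Rintegral_cst//= lebesgue_measure_itv /= lte_fin st -EFinB.
  have igd : lebesgue_measure.-integrable `]s, t] (EFin \o (fun r => phi r - phi s)).
    by apply: eq_integrable (integrableB _ igo (igc (phi s))).
  rewrite -cE -RintegralB//.
  apply: (le_trans (le_normr_Rintegral _ igd)) => //.
  rewrite -cE; apply: le_Rintegral => //; first exact: (integrable_norm igd).
  move=> r /=; rewrite in_itv /= => /andP[sr rt].
  apply: (le_trans (hh _ _ s0 sr (le_trans rt tT))).
  rewrite ler_wpM2l//; apply: ge0_ler_powR; rewrite ?nnegrE ?(ltW a0) ?subr_ge0 ?(ltW sr) ?(ltW st)//.
  by rewrite lerD2r.
have tot n N : (N <= 2 ^ n)%N ->
   `|\int[lebesgue_measure]_(r in `[0, dyadic T n N]) phi r -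
    \sum_(i < N) phi (dyadic T n i) * (T / 2 ^+ n)| <=
   N%:R * (C * (T / 2 ^+ n) `^ a * (T / 2 ^+ n)).
  elim: N => [|N IH] hN.
    by rewrite big_ord0 subr0 mul0r /dyadic !mul0r set_itv1 Rintegral_set1 normr0.
  have t0 := dyadic_ge0 n N T0; have tS := dyadic_ltS n N T0.
  have tT := dyadic_le T0 hN.
  have := @Rintegral_itvB R phi (BLeft 0) (BRight (dyadic T n N.+1)) (dyadic T n N)
    (ig 0 _ (lexx _) tT) _ _.
  rewrite !bnd_simp => /(_ t0 (ltW tS)) sp.
  have := step _ _ t0 tS tT; rewrite dyadicS_sub -sp => st.
  rewrite big_ord_recr /= -(@natr1 R N) mulrDl mul1r.
  have := lerD (IH (ltnW hN)) st; apply: le_trans.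
  by apply: le_trans (ler_normD _ _); rewrite le_eqVlt; apply/orP; left; apply/eqP; congr `| _ |; ring.
apply: (@rate_le_dom _ a _ (fun n => (C * T) * (T / 2 ^+ n) `^ a)); last first.
  by apply: rate_le_scale; apply: rate_le_mesh => //; exact: ltW.
move=> n; have := tot n _ (leqnn _).
have -> : dyadic T n (2 ^ n) = T.
  by rewrite /dyadic natrX; field; rewrite expf_neq0.
move=> hn; apply: (le_trans hn); rewrite le_eqVlt; apply/orP; left; apply/eqP.
rewrite natrX; field; by rewrite expf_neq0.
Qed.

(** Exponential decay beats any constant; 2^x >= 1 + x ln 2 gives an explicit
    threshold. *)
Lemma rate_le_eventually (q q0 e : R) (v : nat -> R) : q0 < q -> 0 < e -> rate_le q v ->
  exists N : nat, forall n, (N <= n)%N -> `|v n| <= e * 2 `^ (- (q0 * n%:R)).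
Proof.
move=> qq e0 [C C0 hC].
have l2 : 0 < ln 2 :> R by rewrite ln_gt0// ltr1n.
have d0 : 0 < e * (q - q0) * ln 2 by rewrite !mulr_gt0// subr_gt0.
exists (Num.truncn (C / (e * (q - q0) * ln 2))).+1 => n hn.
apply: (le_trans (hC n)).
have -> : - (q * n%:R) = - ((q - q0) * n%:R) + - (q0 * n%:R) by ring.
rewrite pow2D mulrA ler_wpM2r ?powR_ge0// powRN ler_pdivrMr ?pow2_gt0//.
apply: (@le_trans _ _ (e * (1 + ((q - q0) * n%:R) * ln 2))).
  have : C / (e * (q - q0) * ln 2) <= n%:R.
    apply: le_trans (ltW (truncnS_gt _)) _; by rewrite ler_nat.
  by rewrite ler_pdivrMr//; nra.
apply: ler_wpM2l; first exact: ltW.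
rewrite /powR pnatr_eq0 /=; exact: expR_ge1Dx.
Qed.

End RiemannSums.

Section RegressionRate.
Context {R : realType}.

(** X_n is eventually injective with a uniform constant L, because it converges
    to X, and then the least squares estimator is at distance at most
    L M |Y_n - X_n beta| from beta. The gain from q0 to q absorbs this constant,
    so that any prescribed e > 0 can stand in the conclusion. *)
Lemma regression_rate (M K : nat) (X : 'M[R]_(M, K)) (Xn : nat -> 'M[R]_(M, K))
    (Yn : nat -> 'cV[R]_M) (beta : 'cV[R]_K) (p q q0 e : R) :
  row_free X^T -> 0 < p -> q0 < q -> 0 < e ->
  (forall m k, rate_le p (fun n => (X - Xn n) m k)) ->
  (forall m, rate_le q (fun n => (Yn n - Xn n *m beta) m 0)) ->
  exists N : nat, forall n, (N <= n)%N -> exists b : 'cV[R]_K,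
    unique (is_argmin (Xn n) (Yn n)) b /\
    euclid_norm (beta - b) <= e * 2 `^ (- (q0 * n%:R)).
Proof.
move=> /row_freeP[A' hA'] p0 qq e0 hX hY.
pose A := A'^T; have AX : A *m X = 1%:M by rewrite /A -[X]trmxK -trmx_mul hA' trmx1.
pose a := \sum_j \sum_i `|A i j|.
have a0 : 0 <= a by do 2 (apply: sumr_ge0 => ? _).
have ha j : \sum_i `|A i j| <= a.
  by rewrite /a (bigD1 j)//= lerDl; do 2 (apply: sumr_ge0 => ? _).
have e1 : 0 < (2 * (a + 1) * (M%:R + 1))^-1 :> R.
  by rewrite invr_gt0 !mulr_gt0 ?ltr_wpDl.
have e2 : 0 < e / ((2 * a * M%:R + 1) * (M%:R + 1)) :> R.
  by rewrite divr_gt0// mulr_gt0 ?ltr_wpDl// !mulr_ge0.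
have [N1 hN1] := choice (fun i : 'I_M * 'I_K => rate_le_eventually p0 e1 (hX i.1 i.2)).
have [N2 hN2] := choice (fun m : 'I_M => rate_le_eventually qq e2 (hY m)).
exists (maxn (\max_i N1 i) (\max_i N2 i)) => n; rewrite geq_max => /andP[n1 n2].
have hX' (k : 'I_K) : a * \sum_m `|(X - Xn n) m k| <= 2^-1.
  apply: (@le_trans _ _ (a * \sum_(m < M) (2 * (a + 1) * (M%:R + 1))^-1)).
    rewrite ler_wpM2l//; apply: ler_sum => m _.
    have := hN1 (m, k) n (leq_trans (leq_bigmax (m, k)) n1).
    by rewrite mul0r oppr0 powRr0 mulr1.
  rewrite sumr_const card_ord -[_ *+ M]mulr_natr.
  have M0 : 0 <= M%:R :> R by [].
  rewrite -(ler_pM2l (_ : 0 < 2 * (a + 1) * (M%:R + 1))); last by rewrite !mulr_gt0 ?ltr_wpDl.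
  have -> : 2 * (a + 1) * (M%:R + 1) * (a * ((2 * (a + 1) * (M%:R + 1))^-1 * M%:R)) = a * M%:R.
    by field; rewrite !gt_eqF ?ltr_wpDl.
  by nra.
have inj := perturbed_injectivity AX a0 ha hX'.
have [b [ub hb]] := least_squares (Yn n) (mulr_ge0 (ler0n _ 2) a0) inj.
exists b; split => //; apply: (le_trans (hb beta)).
have M0 : 0 <= M%:R :> R by [].
have hY' : euclid_norm (Yn n - Xn n *m beta) <=
    M%:R * (e / ((2 * a * M%:R + 1) * (M%:R + 1)) * 2 `^ (- (q0 * n%:R))).
  apply: (le_trans (euclid_norm_le_norm1 _)).
  rewrite mulr_natl -[X in _ *+ X](card_ord M) -sumr_const; apply: ler_sum => m _.
  exact: hN2 (leq_trans (leq_bigmax m) n2).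
apply: (@le_trans _ _ ((2 * a * M%:R) *
   (M%:R * (e / ((2 * a * M%:R + 1) * (M%:R + 1)) * 2 `^ (- (q0 * n%:R)))))).
  by apply: ler_wpM2l => //; rewrite !mulr_ge0.
rewrite !mulrA ler_wpM2r ?powR_ge0//.
have s0 : 0 <= 2 * a * M%:R by rewrite !mulr_ge0.
rewrite ler_pdivrMr ?mulr_gt0 ?ltr_wpDl//; nra.
Qed.

End RegressionRate.

(** * The pathwise estimate *)

Section Pathwise.
Context {R : realType} {d K M : nat}.
Variables (T H al q c : R) (mm : nat -> nat).
Variables (theta : 'I_K -> R) (u : R -> 'rV[R]_d -> 'rV[R]_d)
  (sigma : 'I_K -> 'rV[R]_d -> 'rV[R]_d) (f : 'I_M -> 'rV[R]_d -> R)
  (b : R -> 'rV[R]_K) (bb : R -> R -> 'M[R]_K) (y : R -> 'rV[R]_d).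
Hypothesis T0 : 0 < T.
Hypothesis al0 : 0 < al.
Hypothesis alH : al < H.
Hypothesis H1 : H < 1.
Hypothesis adm : admissible H al.
Hypothesis cu : {within [set p : R * 'rV[R]_d | 0 <= p.1 <= T],
  continuous (fun p : R * 'rV[R]_d => u p.1 p.2)}.
Hypothesis sigmaC : forall k j, is_C (Num.truncn al^-1) (fun x => sigma k x 0 j).
Hypothesis fC : forall m, is_C 2 (f m).
Hypothesis sol : is_solution T H u (scale_fields theta sigma) b bb y.
Hypothesis hb : (holder euclid_norm T al b < +oo)%E.

Let hy j : holder_path T al (fun t => y t 0 j).
Proof. by have [h _ _] := sol adm; exact: holder_path_coord. Qed.

Lemma holder_path_lie k m : holder_path T al (fun t => lie (sigma k) (f m) (y t)).
Proof.
apply: holder_path_sum => j; apply: holder_path_mul.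
  apply: (holder_path_comp_C1 hy (f := fun x => sigma k x 0 j)).
  apply: is_C_le (sigmaC k j); rewrite truncn_gt0 invf_ge1//.
  exact: ltW (lt_trans alH H1).
have [_ _ dC] := fC m.
exact: (holder_path_comp_C1 hy (dC j)).
Qed.

Lemma lie_scale k m x : lie (scale_fields theta sigma k) (f m) x = theta k * lie (sigma k) (f m) x.
Proof. by rewrite /lie mulr_sumr; apply: eq_bigr => j _; rewrite /scale_fields mxE mulrA. Qed.

Lemma rate_Xmat m k : rate_le al (fun n => (Xmat T sigma f y - Xmat_n T sigma f y n) m k).
Proof.
have h := holder_path_lie k m.
have := riemann_rate T0 al0 (holder_path_mul h h).
congr (rate_le al _); apply/funext => n; rewrite !mxE; congr (_ - _).
by apply: eq_bigr => i _; rewrite dyadicS_sub expr2.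
Qed.

Hypothesis mn : forall n, (mm n <= n)%N.
Hypothesis hm : forall n, 2 ^- (mm n) <= 2 * 2 `^ (- (c * n%:R)) :> R.
Hypothesis hblock : forall (e : R) (k l : 'I_K), e \in [:: 1; -1] -> rate_le q (fun n =>
  block_error T H (1 + 2 * e * (k == l)%:R + e ^+ 2) (fun t => b t 0 k + e * b t 0 l) n (mm n)).
Hypothesis q1 : q <= al + Num.min (2 * al) 1 - 2 * H.
Hypothesis q2 : q <= 2 * Num.min (2 * al) 1 - 2 * H.
Hypothesis q3 : q <= c * al - 2 * (H - al).

(** [rate_variation] for x = f(y), whose remainder is controlled by
    [sharp_bound]; the weights squared sum up to X_n beta. *)
Lemma rate_Yvec m : rate_le q (fun n =>
  (Yvec_n T H f y n - Xmat_n T sigma f y n *m (\col_k theta k ^+ 2)) m 0).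
Proof.
have [_ hR _] := sol adm.
have hsh := sharp_bound T0 al0 hy cu hR (fC m).
have hg k : holder_path T al (fun t => lie (scale_fields theta sigma k) (f m) (y t)).
  rewrite (_ : (fun t => _) = fun t => theta k * lie (sigma k) (f m) (y t)).
    by apply: holder_path_mul; [exact: holder_path_cst|exact: holder_path_lie].
  by apply/funext => t; rewrite lie_scale.
have hbk k : holder_path T al (fun t => b t 0 k) by exact: holder_path_coord.
have := @rate_variation R K T H al (Num.min (2 * al) 1) q c mm (fun k t => b t 0 k)
  (fun k t => lie (scale_fields theta sigma k) (f m) (y t)) (f m \o y)
  T0 al0 (ltW alH) hbk hg _ mn hm hblock q1 q2 q3.
have hx : exists2 C : R, 0 <= C & forall s t, 0 <= s -> s < t -> t <= T ->
  `|(f m \o y) t - (f m \o y) s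
    - \sum_k lie (scale_fields theta sigma k) (f m) (y s) * (b t 0 k - b s 0 k)| <=
  C * (t - s) `^ Num.min (2 * al) 1.
  have [C C0 hC] := hsh; exists C => // s t s0 st tT.
  have := hC s t s0 st tT; rewrite /sharp /incr.
  by under eq_bigr do rewrite !mxE.
move=> /(_ hx); congr (rate_le q _); apply/funext => n; rewrite !mxE; congr (_ - _).
under [RHS]eq_bigr do rewrite !mxE mulr_suml.
rewrite exchange_big; apply: eq_bigr => i _ /=; rewrite mulr_suml.
by apply: eq_bigr => k _; rewrite lie_scale dyadicS_sub; ring.
Qed.

End Pathwise.

(** * Exponents and the almost sure statement *)

Section Exponents.
Context {R : realType}.
Variables (H eps : R).
Hypothesis hH : 3^-1 < H < 1.
Hypothesis heps : 0 < eps < H.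

(** Up to the factor sqrt n, [rate H n] is 2 to the power - rate_exponent * n. *)
Definition rate_exponent : R := 1 - Num.max H 2^-1.

Lemma rate_exponent_cases :
  (H <= 2^-1 /\ rate_exponent = 2^-1) \/ (2^-1 < H /\ rate_exponent = 1 - H).
Proof.
rewrite /rate_exponent; have [h|h] := leP H 2^-1; [left|right]; split => //.
by field.
Qed.

(** At al = H and eps = 0 all the bounds on q hold, some of them with equality.
    Lowering al by eta lowers the right-hand sides of the tight ones by at most
    3 eta, whereas q goes down by rate_exponent * eps / 2; hence the choice of
    eta <= rate_exponent * eps / 6. *)
Lemma choose_holder_exponent : exists al : R, [/\ 0 < al, al < H, admissible H al &
  let q := rate_exponent * (H - eps / 2) in
  [/\ rate_exponent * (H - eps) < q, q < Num.max H 2^-1 * rate_exponent,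
     q <= al + Num.min (2 * al) 1 - 2 * H, q <= 2 * Num.min (2 * al) 1 - 2 * H
   & q <= rate_exponent * al - 2 * (H - al)]].
Proof.
case/andP: hH => hH1 hH2; case/andP: heps => he1 he2.
have c0 : 0 < rate_exponent <= 2^-1.
  by case: rate_exponent_cases => -[h ->]; apply/andP; split; lra.
case/andP: c0 => c0 c1.
pose lo : R := if H <= 2^-1 then 3^-1 else 2^-1.
have lo0 : 3^-1 <= lo by rewrite /lo; case: ifP => _; lra.
have loH : lo < H by rewrite /lo; case: (leP H 2^-1) => h /=; lra.
pose eta := Num.min (rate_exponent * eps / 6) ((H - lo) / 2).
have eta1 : eta <= rate_exponent * eps / 6 by rewrite /eta ge_min lexx.
have eta2 : eta <= (H - lo) / 2 by rewrite /eta ge_min lexx orbT.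
have ce0 : 0 < rate_exponent * eps by exact: mulr_gt0.
have eta0 : 0 < eta by rewrite /eta lt_min; apply/andP; split; lra.
have ce : rate_exponent * eps <= 2^-1 * eps by rewrite ler_wpM2r// ltW.
exists (H - eta); split; [lra|lra|by apply/andP; split; rewrite -/lo; lra|].
have cM : Num.max H 2^-1 = 1 - rate_exponent by rewrite /rate_exponent; ring.
have Hc : H <= 1 - rate_exponent by rewrite -cM le_max lexx.
have cH0 : 0 < rate_exponent * H by apply: mulr_gt0 => //; lra.
have cH1 : rate_exponent * H <= 2^-1 * H by rewrite ler_wpM2r//; lra.
have ceta : rate_exponent * eta <= 2^-1 * eta by rewrite ler_wpM2r// ltW.
have E : rate_exponent * (H - eps / 2) = rate_exponent * H - rate_exponent * eps / 2 by field.
rewrite /= E.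
split.
- by rewrite mulrBr; lra.
- rewrite cM mulrC.
  have : rate_exponent * H <= rate_exponent * (1 - rate_exponent) by rewrite ler_wpM2l// ltW.
  lra.
- case: rate_exponent_cases => -[h hc].
    by rewrite (_ : Num.min _ _ = 2 * (H - eta)); [lra|apply/min_idPl; lra].
  rewrite (_ : Num.min _ _ = 1); last first.
    by apply/min_idPr; move: eta2; rewrite /lo [H <= _]leNgt h /=; lra.
  have : rate_exponent * H <= rate_exponent by rewrite ler_piMr ?ltW.
  lra.
- case: rate_exponent_cases => -[h hc].
    by rewrite (_ : Num.min _ _ = 2 * (H - eta)); [lra|apply/min_idPl; lra].
  rewrite (_ : Num.min _ _ = 1); last first.
    by apply/min_idPr; move: eta2; rewrite /lo [H <= _]leNgt h /=; lra.
  have : rate_exponent * H <= rate_exponent by rewrite ler_piMr ?ltW.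
  lra.
- by rewrite mulrBr; lra.
Qed.

Lemma le_rate n : (0 < n)%N ->
  2 `^ (- (rate_exponent * (H - eps) * n%:R)) <= rate H n `^ (H - eps).
Proof.
case/andP: heps => he1 he2 n0.
have -> : - (rate_exponent * (H - eps) * n%:R) = - (rate_exponent * n%:R) * (H - eps) by ring.
rewrite -pow2M; apply: ge0_ler_powR; rewrite ?nnegrE ?powR_ge0//; first by lra.
  by rewrite /rate; case: ifP => _; rewrite mulr_ge0 ?powR_ge0 ?sqrtr_ge0.
have -> : rate H n = 2 `^ (- (rate_exponent * n%:R)) * Num.sqrt n%:R.
  rewrite /rate; case: rate_exponent_cases => -[h ->]; [rewrite h|rewrite leNgt h /=];
    by congr (2 `^ (- _) * _); rewrite mulrC.
rewrite ler_peMr ?powR_ge0// -[leLHS]sqrtr1 ler_wsqrtr//.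
by rewrite ler1n.
Qed.

(** The blocks have mesh about 2 ^ (- c n), where c is the rate exponent. Up to
    arbitrarily small powers, freezing the weights then costs 2 ^ (- c H n) and
    the blocks, each made of about 2 ^ ((1 - c) n) intervals, contribute
    2 ^ (- c (1 - c) n), which is at most of the same order since H <= 1 - c. *)
Definition block_level (n : nat) : nat := Num.truncn (rate_exponent * n%:R).

Lemma block_level_le n : (block_level n)%:R <= rate_exponent * n%:R.
Proof.
rewrite truncn_le mulr_ge0//; case/andP: hH => h1 h2.
by case: rate_exponent_cases => -[h ->]; lra.
Qed.

Lemma block_level_leq n : (block_level n <= n)%N.
Proof.
rewrite -(ler_nat R); apply: (le_trans (block_level_le n)).
rewrite ler_piMl//; case/andP: hH => h1 h2.
by case: rate_exponent_cases => -[h ->]; lra.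
Qed.

Lemma block_mesh n : 2 ^- (block_level n) <= 2 * 2 `^ (- (rate_exponent * n%:R)) :> R.
Proof.
rewrite -pow2_Nnat -[X in X * _](powRr1 (ler0n _ 2)) -pow2D ler_pow2.
have := truncnS_gt (rate_exponent * n%:R); rewrite -(@natr1 R (Num.truncn _)) -/(block_level n).
lra.
Qed.

End Exponents.

Section AlmostSure.
Context {R : realType} {d K M : nat}.
Variables (H eps : R).
Hypothesis hH : 3^-1 < H < 1.
Hypothesis heps : 0 < eps < H.
Context {disp : measure_display} {Omega : measurableType disp}.
Variables (P : probability Omega R) (T : R)
    (B : Omega -> R -> 'rV[R]_K) (BB : Omega -> R -> R -> 'M[R]_K)
    (theta : 'I_K -> R) (u : R -> 'rV[R]_d -> 'rV[R]_d)
    (sigma : 'I_K -> 'rV[R]_d -> 'rV[R]_d)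
    (f : 'I_M -> 'rV[R]_d -> R) (y : Omega -> R -> 'rV[R]_d).
Hypothesis T0 : 0 < T.
Hypothesis fB : is_fBm P T H B.
Hypothesis cu : {within [set p : R * 'rV[R]_d | 0 <= p.1 <= T],
    continuous (fun p : R * 'rV[R]_d => u p.1 p.2)}.
Hypothesis sigmaC : forall a : R, admissible H a ->
    forall k j, is_C (Num.truncn a^-1) (fun x => sigma k x 0 j).
Hypothesis fC : forall m, is_C 2 (f m).
Hypothesis sol : {ae P, forall w,
    is_solution T H u (scale_fields theta sigma) (B w) (BB w) (y w)}.
Hypothesis Xfree : {ae P, forall w, row_free (Xmat T sigma f (y w))^T}.

(** The Hoelder exponent and the block level are the same for all omega, so that
    only finitely many almost sure events are intersected. *)
Lemma ae_estimator_rate : {ae P, forall w, forall e : R, 0 < e ->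
  exists N : nat, forall n, (N <= n)%N -> exists b : 'cV[R]_K,
    unique (is_argmin (Xmat_n T sigma f (y w) n) (Yvec_n T H f (y w) n)) b /\
    euclid_norm (\col_k theta k ^+ 2 - b) <=
      e * 2 `^ (- (rate_exponent H * (H - eps) * n%:R))}.
Proof.
have [al [al0 alH adm [q0 qh q1 q2 q3]]] := choose_holder_exponent hH heps.
set q := rate_exponent H * (H - eps / 2) in q0 qh q1 q2 q3.
have H01 : 0 < H < 1 by case/andP: hH => h1 h2; apply/andP; split; lra.
have [_ _ _ hB] := fB.
have sgn (s : bool) : ((-1) ^+ s : R) \in [:: 1; -1].
  by case: s; rewrite ?expr1 ?expr0 !inE eqxx ?orbT.
have hblock : {ae P, forall w, forall i : bool * 'I_K * 'I_K, exists C : R, forall n,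
   block_error T H (1 + 2 * (-1) ^+ i.1.1 * (i.1.2 == i.2)%:R + ((-1) ^+ i.1.1) ^+ 2)
     (fun t => B w t 0 i.1.2 + (-1) ^+ i.1.1 * B w t 0 i.2) n (block_level H n)
     <= C * 2 `^ (- (q * n%:R))}.
  apply: filter_forall => i; apply: (ae_fBm_block_error fB) => //.
  by move=> n; exact: block_level_le.
apply: filterS (filterI (filterI sol Xfree) (filterI hB hblock)) => w [[hsol hfree] [hb hbl]] e e0.
have hal := hb al; rewrite al0 alH in hal; have {}hal := hal isT.
have hbl' (s : R) (k l : 'I_K) : s \in [:: 1; -1] -> rate_le q (fun n =>
    block_error T H (1 + 2 * s * (k == l)%:R + s ^+ 2)
      (fun t => B w t 0 k + s * B w t 0 l) n (block_level H n)).
  rewrite !inE => hs.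
  have [z ->] : exists z : bool, s = (-1) ^+ z.
    by case/orP: hs => /eqP ->; [exists false|exists true]; rewrite ?expr0 ?expr1.
  have [C hC] := hbl (z, k, l); exists `|C| => // n.
  rewrite ger0_norm; last by apply: sumr_ge0.
  by apply: (le_trans (hC n)); rewrite ler_wpM2r ?powR_ge0// ler_norm.
have H1 : H < 1 by case/andP: hH.
apply: (regression_rate hfree al0 q0 e0).
  by move=> m k; exact: (rate_Xmat T0 al0 alH H1 adm (sigmaC adm) fC hsol).
move=> m; apply: (rate_Yvec T0 al0 alH H1 adm cu (sigmaC adm) fC hsol hal
  (block_level_leq hH) (block_mesh H) hbl' q1 q2 q3).
Qed.

End AlmostSure.

(** * The theorem *)

Theorem theorem5p4 (R : realType) (d K M : nat) (H eps : R)
    (hH : 3^-1 < H < 1) (heps : 0 < eps < H) :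
  exists (C1 : constant_fun R K M) (c c' : R -> R),
  forall (disp : measure_display) (Omega : measurableType disp)
    (P : probability Omega R) (T : R)
    (B : Omega -> R -> 'rV[R]_K) (BB : Omega -> R -> R -> 'M[R]_K)
    (theta : 'I_K -> R) (u : R -> 'rV[R]_d -> 'rV[R]_d)
    (sigma : 'I_K -> 'rV[R]_d -> 'rV[R]_d)
    (f : 'I_M -> 'rV[R]_d -> R) (y : Omega -> R -> 'rV[R]_d),
  0 < T ->
  is_fBm P T H B ->
  (H <= 2^-1 -> {ae P, forall w, is_rough_lift T H (B w) (BB w)}) ->
  (forall k, 0 <= theta k) ->
  {within [set p : R * 'rV[R]_d | 0 <= p.1 <= T],
    continuous (fun p : R * 'rV[R]_d => u p.1 p.2)} ->
  (forall a : R, admissible H a ->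
    forall k j, is_C (Num.truncn a^-1) (fun x => sigma k x 0 j)) ->
  (forall m, is_C 2 (f m)) ->
  {ae P, forall w,
    is_solution T H u (scale_fields theta sigma) (B w) (BB w) (y w)} ->
  {ae P, forall w, row_free (Xmat T sigma f (y w))^T} ->
  {ae P, forall w, Yvec T H f (y w) != 0} ->
  let beta : 'cV[R]_K := \col_k theta k ^+ 2 in
  let C w := eval_constant C1 T (H - eps) theta sigma f (B w) (y w) in
  {ae P, forall w, exists n0 : nat, forall n : nat, (n0 <= n)%N ->
    exists beta_n : 'cV[R]_K,
      unique (is_argmin (Xmat_n T sigma f (y w) n) (Yvec_n T H f (y w) n)) beta_n /\
      euclid_norm (beta - beta_n) <= c (C w) * rate H n `^ (H - eps)} /\
  (forall k, 0 < beta k 0 ->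
   {ae P, forall w, exists n0 : nat, forall n : nat, (n0 <= n)%N ->
    exists beta_n : 'cV[R]_K,
      [/\ unique (is_argmin (Xmat_n T sigma f (y w) n) (Yvec_n T H f (y w) n)) beta_n,
          0 < beta_n k 0
        & `|theta k - Num.sqrt (beta_n k 0)|
          <= c' (Num.max (C w) (beta k 0)^-1) * rate H n `^ (H - eps)]}).
Proof.
exists (fun _ _ _ _ _ _ => 0), (fun=> 1), (fun=> 1).
move=> disp Omega P T B BB theta u sigma f y T0 fB _ th0 cu sigmaC fC sol Xfree _ beta C.
have rate_ge n : (0 < n)%N -> 2 `^ (- (rate_exponent H * (H - eps) * n%:R)) <= rate H n `^ (H - eps).
  exact: le_rate.
have main := ae_estimator_rate hH heps T0 fB cu sigmaC fC sol Xfree.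
split.
  apply: filterS main => w /(_ 1 ltr01)[N hN]; exists N.+1 => n hn.
  have [b [ub hb]] := hN n (ltnW hn); exists b; split => //.
  by apply: (le_trans hb); rewrite !mul1r rate_ge// (leq_trans _ hn).
move=> k; rewrite mxE => bk; apply: filterS main => w h.
have tk : 0 < theta k by rewrite lt_def th0 andbT; apply: contraTneq bk => ->; rewrite expr0n ltxx.
(* The first term keeps b k positive, the second absorbs theta k + sqrt (b k). *)
have [|N hN] := h (Num.min (theta k ^+ 2 / 2) (theta k)).
  by rewrite lt_min tk divr_gt0.
exists N.+1 => n hn; have [b [ub hb]] := hN n (ltnW hn); exists b.
set r := 2 `^ _ in hb.
have r0 : 0 <= r by exact: powR_ge0.
have c0 : 0 <= rate_exponent H.
  by case/andP: hH => h1 h2; case: (rate_exponent_cases H) => -[h3 ->]; lra.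
have r1 : r <= 1.
  rewrite -(powRr0 2) ler_pow2 oppr_le0 !mulr_ge0//.
  by case/andP: heps => h1 h2; lra.
have hbk : `|theta k ^+ 2 - b k 0| <= Num.min (theta k ^+ 2 / 2) (theta k) * r.
  by apply: le_trans hb; have := coord_le_euclid_norm (beta - b) k 0; rewrite !mxE.
have b1 : `|theta k ^+ 2 - b k 0| <= theta k ^+ 2 / 2.
  apply: (le_trans hbk); rewrite -[leRHS]mulr1; apply: ler_pM => //.
    by rewrite le_min !divr_ge0 ?ltW.
  by rewrite ge_min lexx.
have b2 : `|theta k ^+ 2 - b k 0| <= theta k * r.
  by apply: (le_trans hbk); rewrite ler_wpM2r// ge_min lexx orbT.
have b0 : 0 < b k 0 by move: b1; rewrite ler_norml => /andP[_]; lra.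
split => //; rewrite mul1r; apply: (@le_trans _ _ r); last first.
  by apply: rate_ge; rewrite (leq_trans _ hn).
rewrite -(ler_pM2l tk); apply: le_trans b2.
have s0 : 0 <= Num.sqrt (b k 0) by exact: sqrtr_ge0.
rewrite -[X in _ <= `|_ - X|](sqr_sqrtr (ltW b0)) subr_sqr normrM mulrC.
by rewrite ler_wpM2l// ger0_norm ?lerDl// addr_ge0// ltW.
Qed.
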